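(* Let $d\ge3$, $\gamma=-2$, and let $f_{\rm in}\in L^1_2(\mathbb{R}^d)\cap L\log L(\mathbb{R}^d)$ be nonnegative with $\int f_{\rm in}\,dv=1$, $\int v f_{\rm in}\,dv=0$, $\int |v|^2 f_{\rm in}\,dv=d$. Let $f\in\mathcal{Y}_0(f_{\rm in})$. Assume that there exists $\boldsymbol{\Psi}\in\mathcal{C}([0,\infty))$ such that $$m_{\boldsymbol{\Psi}}(f):=\int_{\mathbb{R}^d}f(v)\,\boldsymbol{\Psi}(|v|^2)\,dv<+\infty\qquad\text{and}\qquad\lim_{r\to\infty}\frac{\boldsymbol{\Psi}(r)}{r}=+\infty.$$ Then, for any $\varepsilon>0$, there exists $C>0$ depending only on $\varepsilon$, $\|f\|_{L^1_2}$, an upper bound of $m_{\boldsymbol{\Psi}}(f)$ and an upper bound of $H(f)$ (with $d$ and $\boldsymbol{\Psi}$ fixed) such that for any smooth function $\phi$ on $\mathbb{R}^d$, $$-\int_{\mathbb{R}^d}\phi^2\,\boldsymbol{c}_\gamma[f]\,dv\le\varepsilon\int_{\mathbb{R}^d}\left|\nabla\left(\langle v\rangle^{\frac\gamma2}\phi(v)\right)\right|^2dv+C\int_{\mathbb{R}^d}\phi^2\langle v\rangle^\gamma\,dv.$$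
   Context: Notation: $\langle v\rangle=\sqrt{1+|v|^2}$; $\|f\|_{L^p_s}=\left(\int_{\mathbb{R}^d}|f|^p\langle v\rangle^s\,dv\right)^{1/p}$ and $L^p_s(\mathbb{R}^d)$ is the corresponding space; $L\log L(\mathbb{R}^d)$ is the space of $f$ with $\int |f||\log|f||\,dv<\infty$. $H(f)=\int_{\mathbb{R}^d}f\log f\,dv$. $\boldsymbol{c}_\gamma[f](v)=-(d-1)(\gamma+d)\int_{\mathbb{R}^d}|v-v_*|^\gamma f(v_* )\,dv_*$. The class $\mathcal{Y}_0(f_{\rm in})$ is the set of (nonnegative) $f\in L^1_2(\mathbb{R}^d)$ such that $\int f\,\varphi\,dv=\int f_{\rm in}\,\varphi\,dv$ for $\varphi\in\{1,v,|v|^2\}$ and $H(f)\le H(f_{\rm in})$. *)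

(* Defs.v *)
From HB Require Import structures.
From mathcomp Require Import all_boot all_order all_algebra.
From mathcomp Require Import all_classical all_reals all_analysis.

Set Implicit Arguments.
Unset Strict Implicit.
Unset Printing Implicit Defensive.

Import Order.TTheory GRing.Theory Num.Theory.
Import numFieldNormedType.Exports.

Local Open Scope classical_set_scope.
Local Open Scope ring_scope.

(* R^n is 'rV[R]_n, with its library topology. Its sigma-algebra is the one
   generated by the coordinates; over R it is the Borel sigma-algebra. *)
Definition rV_display : measure_display -> measure_display.
Proof. exact. Qed.

Section measurable_rV.
Context {disp : measure_display} {T : sigmaRingType disp} (n : nat).

Definition rV_coord (i : 'I_n) (v : 'rV[T]_n) : T := v ord0 i.

Let rV_set0 : g_sigma_preimage rV_coord set0.
Proof. exact: sigma_algebra0. Qed.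

Let rV_setC A : g_sigma_preimage rV_coord A -> g_sigma_preimage rV_coord (~` A).
Proof. exact: sigma_algebraC. Qed.

Let rV_bigcup (F : (set 'rV[T]_n)^nat) :
  (forall i, g_sigma_preimage rV_coord (F i)) ->
  g_sigma_preimage rV_coord (\bigcup_i (F i)).
Proof. exact: sigma_algebra_bigcup. Qed.

HB.instance Definition _ := @isMeasurable.Build (rV_display disp)
  'rV[T]_n (g_sigma_preimage rV_coord) rV_set0 rV_setC rV_bigcup.

End measurable_rV.

Section measurable_rV_theory.
Context {R : realType}.

Lemma measurable_rV_coord n (i : 'I_n) :
  measurable_fun [set: 'rV[R]_n] (fun v : 'rV[R]_n => v ord0 i).
Proof.
move=> _ Y mY; rewrite setTI; apply: sub_sigma_algebra => /=.
rewrite -bigcup_seq/=; exists i => /=; first by rewrite mem_index_enum.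
by exists Y => //; rewrite setTI.
Qed.

Lemma measurable_fun_rVP d1 (T1 : measurableType d1) n (f : T1 -> 'rV[R]_n) :
  (forall i, measurable_fun [set: T1] (fun x => f x ord0 i)) ->
  measurable_fun [set: T1] f.
Proof.
move=> mf.
suff h : g_sigma_preimage (fun i => @rV_coord _ R n i \o f) `<=` measurable.
  rewrite g_sigma_preimage_comp in h.
  by move=> _ A mA; apply: h; exists A.
apply: smallest_sub; first exact: sigma_algebra_measurable.
case: n => [|n] in f mf *; first by rewrite big_ord0.
rewrite -bigcup_mkord_ord; apply: bigcup_sub => i Ii.
by move=> A [B mB <-]; exact: mf.
Qed.

Definition rV_cons n (p : R * 'rV[R]_n) : 'rV[R]_n.+1 := row_mx p.1%:M p.2.

Definition rV_uncons n (v : 'rV[R]_n.+1) : R * 'rV[R]_n :=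
  ((v : 'rV[R]_(1 + n)) ord0 (lshift n ord0), rsubmx (v : 'rV[R]_(1 + n))).

Lemma rV_consK n : cancel (@rV_cons n) (@rV_uncons n).
Proof.
by case=> x v; rewrite /rV_uncons/= /rV_cons row_mxEl row_mxKr mxE.
Qed.

Lemma measurable_rV_cons n : measurable_fun [set: R * 'rV[R]_n] (@rV_cons n).
Proof.
apply: measurable_fun_rVP => i.
case: (@split_ordP 1 n i) => j ->.
  rewrite (_ : (fun _ => _) = fst); [exact: measurable_fst|].
  by apply/funext => x; rewrite /rV_cons (@row_mxEl _ 1 1 n) mxE (ord1 j).
rewrite (_ : (fun _ => _) = (fun v : 'rV[R]_n => v ord0 j) \o snd); last first.
  by rewrite funeqE => x /=; rewrite /rV_cons (@row_mxEr _ 1 1 n).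
by apply: measurableT_comp => //; exact: measurable_rV_coord.
Qed.

Lemma measurable_rV_uncons n : measurable_fun [set: 'rV[R]_n.+1] (@rV_uncons n).
Proof.
apply: measurable_fun_pair; first exact: measurable_rV_coord.
apply: measurable_fun_rVP => i.
under eq_fun do rewrite mxE.
exact: measurable_rV_coord.
Qed.

End measurable_rV_theory.

Section lebesgue_rV_step.
Context {R : realType} (n : nat).
Variable mu : {sigma_finite_measure set 'rV[R]_n -> \bar R}.
Local Open Scope ereal_scope.

Definition lebesgue_rV_step : set 'rV[R]_n.+1 -> \bar R :=
  pushforward (@lebesgue_measure R \x mu) (@rV_cons R n).

Let m0 : lebesgue_rV_step set0 = 0.
Proof. by rewrite /lebesgue_rV_step /pushforward preimage_set0 measure0. Qed.

Let m_ge0 A : 0 <= lebesgue_rV_step A.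
Proof. exact: (@measure_ge0 _ _ _ (@lebesgue_measure R \x mu)). Qed.

Let m_sigma_additive : semi_sigma_additive lebesgue_rV_step.
Proof.
move=> F mF tF mUF; rewrite /lebesgue_rV_step /pushforward preimage_bigcup.
have mcons A : measurable A -> measurable (@rV_cons R n @^-1` A).
  by move=> mA; rewrite -[X in measurable X]setTI; exact: measurable_rV_cons.
apply: measure_semi_sigma_additive.
- by move=> k; exact: mcons.
- apply/trivIsetP => /= i j _ _ ij; rewrite -preimage_setI.
  by move/trivIsetP : tF => /(_ _ _ _ _ ij) ->//; rewrite preimage_set0.
- by rewrite -preimage_bigcup; exact: mcons.
Qed.

HB.instance Definition _ := isMeasure.Build _ _ _ lebesgue_rV_step
  m0 m_ge0 m_sigma_additive.

Let m_sigma_finite : sigma_finite setT lebesgue_rV_step.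
Proof.
have /sigma_finiteP[F [TF ndF Foo]] := sigma_finiteT (@lebesgue_measure R).
have /sigma_finiteP[G [TG ndG Goo]] := sigma_finiteT mu.
exists (fun k => @rV_uncons R n @^-1` (F k `*` G k)).
  rewrite -preimage_bigcup; apply/seteqP; split => // v _ /=.
  case: (rV_uncons v) => x w.
  have [i _ Fix] : (\bigcup_i F i) x by rewrite -TF.
  have [j _ Gjw] : (\bigcup_i G i) w by rewrite -TG.
  exists (maxn i j) => //; split => /=.
    by move: x Fix; exact/subsetPset/ndF/leq_maxl.
  by move: w Gjw; exact/subsetPset/ndG/leq_maxr.
move=> k; have [mF oF] := Foo k; have [mG oG] := Goo k; split.
  rewrite -[X in measurable X]setTI.
  by apply: measurable_rV_uncons => //; exact: measurableX.
rewrite /lebesgue_rV_step /pushforward -comp_preimage.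
rewrite (_ : _ \o _ = id); last by apply/funext => p /=; rewrite rV_consK.
by rewrite preimage_id product_measure1E// lte_mul_pinfty// ge0_fin_numE.
Qed.

HB.instance Definition _ := Measure_isSigmaFinite.Build _ _ _ lebesgue_rV_step
  m_sigma_finite.

End lebesgue_rV_step.

Fixpoint lebesgue_rV {R : realType} (n : nat) :
    {sigma_finite_measure set 'rV[R]_n -> \bar R} :=
  match n with
  | 0 => \d_(0 : 'rV[R]_0)
  | n'.+1 => lebesgue_rV_step (lebesgue_rV n')
  end.

Lemma lebesgue_rV_box (R : realType) n (A : 'I_n -> set R) :
  (forall i, measurable (A i)) ->
  lebesgue_rV n [set v : 'rV[R]_n | forall i, A i (v ord0 i)] =
  (\prod_(i < n) @lebesgue_measure R (A i))%E.
Proof.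
elim: n A => [|n IH] A mA.
  rewrite big_ord0 /= diracE mem_set//= => -[].
  by [].
rewrite big_ord_recl -IH => [|i]; last exact: mA.
rewrite /= /lebesgue_rV_step /pushforward.
rewrite -product_measure1E//; last first.
  rewrite (_ : [set _ | _] = \bigcap_(i in [set: 'I_n])
    ((fun v : 'rV[R]_n => v ord0 i) @^-1` (A (lift ord0 i)))); last first.
    by apply/seteqP; split => v /= h i; [move=> _|]; exact: h.
  apply: fin_bigcap_measurable => // i _.
  by rewrite -[X in measurable X]setTI; exact: measurable_rV_coord.
  exact: mA.
congr (_ _); apply/seteqP; split => -[x v] /=.
  move=> h; split => [|i].
    have := h ord0; rewrite (_ : ord0 = @lshift 1 n ord0); last exact/val_inj.
    by rewrite /rV_cons (@row_mxEl _ 1 1 n) mxE.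
  have := h (lift ord0 i).
  by rewrite (_ : lift _ _ = @rshift 1 n i) /rV_cons ?(@row_mxEr _ 1 1 n)//; exact/val_inj.
move=> [h0 h] i; case: (@split_ordP 1 n i) => j ->.
  rewrite ord1 /rV_cons (@row_mxEl _ 1 1 n) mxE /= mulr1n.
  by rewrite (_ : @lshift 1 n ord0 = ord0 :> 'I_n.+1)//; exact/val_inj.
rewrite /rV_cons (@row_mxEr _ 1 1 n).
by rewrite (_ : @rshift 1 n j = lift ord0 j :> 'I_n.+1)//; exact/val_inj.
Qed.

Section function_spaces.
Context {R : realType} {d : nat}.
Implicit Types (f : 'rV[R]_d -> R) (v : 'rV[R]_d).

(* The norm `|v| of the library on 'rV[R]_d is the sup norm. *)
Definition enorm v : R := Num.sqrt (\sum_(i < d) v ord0 i ^+ 2).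

Definition bracket v : R := Num.sqrt (1 + enorm v ^+ 2).

Local Open Scope ereal_scope.

Definition wnorm (p s : R) f : \bar R :=
  (\int[lebesgue_rV d]_v (`|f v| `^ p * bracket v `^ s)%:E) `^ p^-1.

Definition in_Lps (p s : R) f : Prop :=
  measurable_fun [set: 'rV[R]_d] f /\ wnorm p s f < +oo.

(* ln 0 = 0 in the library, which gives 0 log 0 = 0 here and in [entropy]. *)
Definition in_LlogL f : Prop :=
  measurable_fun [set: 'rV[R]_d] f /\
  \int[lebesgue_rV d]_v (`|f v| * `|ln `|f v| |)%:E < +oo.

Definition ae_nonneg f : Prop := {ae lebesgue_rV d, forall v, (0 <= f v)%R}.

Definition entropy f : \bar R :=
  \int[lebesgue_rV d]_v (f v * ln (f v))%:E.

Definition mass f : \bar R := \int[lebesgue_rV d]_v (f v)%:E.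

Definition momentum f (i : 'I_d) : \bar R :=
  \int[lebesgue_rV d]_v (f v * v ord0 i)%:E.

Definition energy f : \bar R :=
  \int[lebesgue_rV d]_v (f v * enorm v ^+ 2)%:E.

Definition class_Y0 fin f : Prop :=
  [/\ ae_nonneg f, in_Lps 1 2 f,
      [/\ mass f = mass fin,
          forall i, momentum f i = momentum fin i &
          energy f = energy fin]
    & entropy f <= entropy fin].

(* Extended-real valued: for nonnegative f the integral may be infinite at
   some points v. *)
Definition c_coef (gamma : R) f v : \bar R :=
  (- ((d%:R - 1) * (gamma + d%:R)))%:E *
  \int[lebesgue_rV d]_w (enorm (v - w)%R `^ gamma * f w)%:E.

Definition m_Psi (Psi : R -> R) f : \bar R :=
  \int[lebesgue_rV d]_v (f v * Psi (enorm v ^+ 2))%:E.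

Local Close Scope ereal_scope.

Definition partial f (i : 'I_d) v : R := 'D_(delta_mx ord0 i) f v.

Definition grad f v : 'rV[R]_d := \row_i partial f i v.

Fixpoint class_C (k : nat) f : Prop :=
  match k with
  | 0 => continuous f
  | k'.+1 => (forall v, differentiable f v) /\
             (forall i, class_C k' (partial f i))
  end.

Definition smooth f : Prop := forall k, class_C k f.

End function_spaces.

(* Main.v *)
(* With gamma = -2 and g = phi / <v>, the left-hand side is a constant times the
   double integral of g(v)^2 <v>^2 f(w) / |v - w|^2. Since
   <v>^2 <= 2 |v - w|^2 + 2 <w>^2, it is controlled by the mass of f and by the
   potential of <w>^2 f(w). The bounds on the entropy and on m_Psi make <w>^2 f
   uniformly integrable: outside a set carrying mass at most delta, both f and
   |w| are bounded. On the small-mass part, Tonelli and Hardy's inequality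
   (in the variable v, for g) give delta times the Dirichlet integral of g. The
   remaining part is dominated by a multiple of exp (- 2 |w|^2), whose potential
   is bounded, again by Hardy's inequality, in the variable w.

   Hardy's inequality comes from integrating the divergence of g^2 V, V being a
   regularisation of (v - w) / |v - w|^2; the integral of a derivative vanishes
   by translation invariance of the Lebesgue measure. *)
Require Import Defs.
From mathcomp Require Import all_boot all_order all_algebra.
From mathcomp Require Import all_classical all_reals all_analysis.
From mathcomp Require Import measurable_realfun ring lra.

Set Implicit Arguments.
Unset Strict Implicit.
Unset Printing Implicit Defensive.

Import Order.TTheory GRing.Theory Num.Theory.
Import numFieldNormedType.Exports.

Local Open Scope classical_set_scope.
Local Open Scope ring_scope.

(** * Lebesgue measure on row vectors *)

(** An open set is the union of the boxes with rational centre and half-width 1/(n+1) that it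
    contains. There are countably many of them, and each is a finite intersection of coordinate
    preimages. *)
Lemma open_measurable_rV (R : realType) d (U : set 'rV[R]_d) :
  open U -> measurable U.
Proof.
move=> oU.
pose box (q : 'rV[rat]_d * nat) : set 'rV[R]_d :=
  [set v | forall i, `|v ord0 i - ratr (q.1 ord0 i)| < q.2.+1%:R^-1].
pose B q := if pselect (box q `<=` U) then box q else set0.
have -> : U = \bigcup_q B q.
  apply/seteqP; split => [v Uv|v [q _]]; last first.
    by rewrite /B; case: pselect => //= qU /qU.
  have /nbhs_ballP[e /= e0 veU] : nbhs v U by exact: open_nbhs_nbhs.
  (* A half-width below e / 2 keeps the whole box within distance e of [v], by the triangle
     inequality through the rational centre. *)
  have [k ke] : exists k : nat, k.+1%:R^-1 < e / 2.
    have [k _ /(_ k) /= h] := near_infty_natSinv_lt (PosNum (divr_gt0 e0 (ltr0Sn R 1))).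
    by exists k; exact: h.
  have k0 : 0 < k.+1%:R^-1 :> R by rewrite invr_gt0.
  have /choice[q qv] : forall i : 'I_d, exists q : rat,
      `|v ord0 i - ratr q| < k.+1%:R^-1.
    move=> i.
    have /rat_in_itvoo[q] : v ord0 i - k.+1%:R^-1 < v ord0 i + k.+1%:R^-1.
      by rewrite ltrBlDr -addrA ltrDl addr_gt0.
    rewrite in_itv/= => /andP[h1 h2]; exists q.
    by rewrite ltr_distlC h1 h2.
  exists (\row_i q i, k) => //; rewrite /B; case: pselect => [_ i|].
    by rewrite /= mxE.
  case=> w wq; apply: veU; split => // a i; rewrite (ord1 a).
  have := qv i; have := wq i; rewrite /= mxE => h1 h2.
  rewrite /ball/= (le_lt_trans (ler_distD (ratr (q i)) _ _))//.
  by rewrite (splitr e) ltrD// ?(lt_trans h2)// distrC (lt_trans h1).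
apply: countable_bigcupT_measurable; first exact: countableP.
move=> q; rewrite /B; case: pselect => //= ?.
rewrite (_ : box q = \bigcap_(i in [set: 'I_d])
  ((fun v : 'rV[R]_d => v ord0 i) @^-1` ball (ratr (q.1 ord0 i) : R) q.2.+1%:R^-1)).
  apply: fin_bigcap_measurable => // i _.
  rewrite -[X in measurable X]setTI; apply: measurable_rV_coord => //.
  exact: measurable_ball.
apply/seteqP; split => v h i; first by move=> _; rewrite /ball/= distrC; exact: h.
by have := h i I; rewrite /ball/= distrC.
Qed.

Lemma continuous_measurable_rV (R : realType) d (f : 'rV[R]_d -> R) :
  continuous f -> measurable_fun setT f.
Proof.
move=> /continuousP cf; apply: (measurability _ (RGenOpens.measurableE R)).
move=> _ [_ [a [b ->] <-]]; rewrite setTI; apply: open_measurable_rV.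
exact/cf/interval_open.
Qed.

(** The image of Lebesgue measure under a translation agrees with it on half-open intervals, hence
    everywhere by uniqueness. *)
Lemma ge0_integral_shift (R : realType) (a : R) (h : R -> \bar R) :
  measurable_fun setT h -> (forall x, 0 <= h x)%E ->
  (\int[lebesgue_measure]_x h (x + a)%R = \int[lebesgue_measure]_x h x)%E.
Proof.
move=> mh h0.
have ms : measurable_fun setT
    ((fun x => x + a) : measurableTypeR R -> measurableTypeR R).
  exact: measurable_funD.
have := @ge0_integral_pushforward _ _ _ _ R _ ms lebesgue_measure setT h
  measurableT mh (fun y _ => h0 y).
rewrite preimage_setT => <-; apply: eq_measure_integral => //= A mA _.
apply/esym/(@lebesgue_measure_unique _ (pushforward lebesgue_measure _)) => //.
move=> _ [[b c]] _ <-; rewrite /= /pushforward.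
rewrite (_ : _ @^-1` _ = `]b - a, c - a]%classic); last first.
  by apply/seteqP; split => x /=; rewrite !in_itv/= ltrBlDr lerBrDr.
rewrite !lebesgue_measure_itv/= !lte_fin ltrD2r.
by case: ifPn => // _; rewrite -!EFinB opprB addrA subrK.
Qed.

(** The measure in dimension n + 1 is the image of a product measure under [rV_cons], so a change of
    variables followed by Tonelli applies. This drives the inductions on the dimension. *)
Lemma ge0_integral_rVS (R : realType) n (h : 'rV[R]_n.+1 -> \bar R) :
  measurable_fun setT h -> (forall v, 0 <= h v)%E ->
  (\int[lebesgue_rV n.+1]_v h v =
   \int[lebesgue_measure]_x \int[lebesgue_rV n]_w h (rV_cons (x, w)))%E.
Proof.
move=> mh h0.
have mc : measurable_fun [set: measurableTypeR R * 'rV[R]_n] (@rV_cons R n).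
  exact: measurable_rV_cons.
have mhc := measurableT_comp mh mc.
transitivity (\int[(@lebesgue_measure R \x lebesgue_rV n)%E]_z
    (h \o @rV_cons R n) z)%E; last first.
  by rewrite fubini_tonelli1//= => z; exact: h0.
have := ge0_integral_pushforward mc (@lebesgue_measure R \x lebesgue_rV n)%E
  measurableT mh (fun y _ => h0 y).
rewrite preimage_setT => <-.
apply: eq_measure_integral => A mA _.
reflexivity.
Qed.

Lemma measurable_rVD (R : realType) d (e : 'rV[R]_d) :
  measurable_fun setT (fun v : 'rV[R]_d => v + e).
Proof.
apply: measurable_fun_rVP => i; under eq_fun do rewrite mxE.
by apply: measurable_funD => //; exact: measurable_rV_coord.
Qed.

(** Induction on the dimension: the one-dimensional translation handles the first coordinate, the
    induction hypothesis the remaining ones. *)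
Lemma ge0_integral_rV_shift (R : realType) d (e : 'rV[R]_d)
    (h : 'rV[R]_d -> \bar R) :
  measurable_fun setT h -> (forall v, 0 <= h v)%E ->
  (\int[lebesgue_rV d]_v h (v + e)%R = \int[lebesgue_rV d]_v h v)%E.
Proof.
elim: d e h => [|n IH] e h mh h0.
  by apply: eq_integral => v _; congr h; apply/rowP => -[].
have mhe : measurable_fun setT (fun v : 'rV[R]_n.+1 => h (v + e)).
  by apply: measurableT_comp => //; exact: measurable_rVD.
have mhc := measurableT_comp mh (@measurable_rV_cons R n).
rewrite (ge0_integral_rVS mhe (fun v => h0 _)) (ge0_integral_rVS mh h0).
have [a [e' ->]] : exists a e', e = rV_cons (a, e').
  exists ((e : 'rV_(1 + n)) ord0 (lshift n ord0)), (rsubmx (e : 'rV_(1 + n))).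
  rewrite /rV_cons /= -[LHS](@hsubmxK _ 1 1 n).
  congr (@row_mx R 1 1 n _ _); apply/rowP => i; rewrite !mxE (ord1 i).
  by rewrite eqxx mulr1n.
rewrite -[RHS](ge0_integral_shift a); last first.
- by move=> x; apply: integral_ge0.
- by apply: (measurable_fun_fubini_tonelli_F (h \o @rV_cons R n)) => // z; exact: h0.
apply: eq_integral => x _.
rewrite -[RHS](IH e')//; last first.
  exact: (measurableT_comp mhc (pair1_measurable (x + a : R))).
apply: eq_integral => w _; congr h.
by rewrite /rV_cons /= (@add_row_mx R 1 1 n) -raddfD.
Qed.

(** * Integrals of directional derivatives *)

(** Both difference quotients are the same function of h. Directional derivatives thus become
    one-variable derivatives, to which the fundamental theorem of calculus applies. *)
Lemma is_derive_line (R : realType) d (u : 'rV[R]_d -> R) (v e : 'rV[R]_d)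
    (t l : R) :
  is_derive (v + t *: e) e u l -> is_derive t 1 (fun s : R => u (v + s *: e)) l.
Proof.
have E : (fun h : R => h^-1 *: (((fun s => u (v + s *: e)) \o shift t) (h *: 1) -
      u (v + t *: e))) =
    (fun h : R => h^-1 *: ((u \o shift (v + t *: e)) (h *: e) - u (v + t *: e))).
  apply/funext => h /=; congr (_ *: (u _ - _)).
  by rewrite [h *: 1]mulr1 scalerDl addrCA.
move=> [du <-]; split; first by rewrite /derivable E; exact: du.
by rewrite /derive E.
Qed.

Lemma continuous_line (R : realType) d (u : 'rV[R]_d -> R) (v e : 'rV[R]_d) :
  continuous u -> continuous (fun s : R => u (v + s *: e)).
Proof.
move=> cu s; apply: continuous_comp; last exact: cu.
apply: continuousD; first exact: cst_continuous.
exact: scalel_continuous.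
Qed.

Lemma integral_line (R : realType) d (u u' : 'rV[R]_d -> R) (v e : 'rV[R]_d) :
  continuous u -> continuous u' ->
  (forall w, is_derive w e u (u' w)) ->
  (\int[lebesgue_measure]_(t in `[0%R, 1%R]) (u' (v + t *: e)%R)%:E =
    (u (v + e)%R)%:E - (u v)%:E)%E.
Proof.
move=> cu cu' du.
rewrite (@continuous_FTC2 _ (fun t => u' (v + t *: e)) (fun t => u (v + t *: e))).
- by rewrite scale1r scale0r addr0.
- exact: ltr01.
- exact/continuous_subspaceT/continuous_line.
- split.
  + by move=> t _; have [] := is_derive_line (du (v + t *: e)).
  + exact/cvg_at_right_filter/continuous_line.
  + exact/cvg_at_left_filter/continuous_line.
- by move=> t _; rewrite derive1E; have [] := is_derive_line (du (v + t *: e)).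
Qed.

Lemma integrable_rV_shift (R : realType) d (e : 'rV[R]_d) (h : 'rV[R]_d -> R) :
  (lebesgue_rV d).-integrable setT (EFin \o h) ->
  (lebesgue_rV d).-integrable setT (EFin \o (fun v => h (v + e))).
Proof.
move=> /integrableP[mh hoo]; apply/integrableP; split.
  exact: (measurableT_comp mh (measurable_rVD e)).
rewrite (ge0_integral_rV_shift e (h := fun v => `|(h v)%:E|%E))//.
exact: measurableT_comp.
Qed.

Lemma integral_rV_shift (R : realType) d (e : 'rV[R]_d) (h : 'rV[R]_d -> R) :
  measurable_fun setT h ->
  (\int[lebesgue_rV d]_v (h (v + e)%R)%:E = \int[lebesgue_rV d]_v (h v)%:E)%E.
Proof.
move=> /measurable_EFinP mh; rewrite integralE [RHS]integralE; congr (_ - _)%E.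
- rewrite -[RHS](ge0_integral_rV_shift e (measurable_funepos mh)).
    by apply: eq_integral => v _; rewrite !funeposE.
  by move=> v; rewrite funeposE le_max lexx orbT.
- rewrite -[RHS](ge0_integral_rV_shift e (measurable_funeneg mh)).
    by apply: eq_integral => v _; rewrite !funenegE.
  by move=> v; rewrite funenegE le_max lexx orbT.
Qed.

(* Averaging over translates along [e] turns the integral of the derivative
   into the integral of [u (v + e) - u v]. *)
Lemma integral_deriv_eq0 (R : realType) d (u u' : 'rV[R]_d -> R)
    (e : 'rV[R]_d) :
  continuous u -> continuous u' ->
  (forall w, is_derive w e u (u' w)) ->
  (lebesgue_rV d).-integrable setT (EFin \o u) ->
  (lebesgue_rV d).-integrable setT (EFin \o u') ->
  (\int[lebesgue_rV d]_v (u' v)%:E = 0)%E.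
Proof.
move=> cu cu' du iu iu'.
pose I : set (measurableTypeR R) := `[0, 1]%classic.
have mI : measurable I by exact: measurable_itv.
have lI : lebesgue_measure I = 1%E.
  by rewrite /I lebesgue_measure_itv/= lte_fin ltr01 oppr0 adde0.
have {}lI : (\int[@lebesgue_measure R]_x (\1_I x)%:E = 1)%E.
  by rewrite integral_indic// setIT; exact: lI.
(* [F] lives on [0, 1] times the space and is integrated in both orders by Fubini: first in space,
   translation invariance gives the integral of [u']; first along the segment, one gets u (v + e) -
   u v. *)
pose F (z : measurableTypeR R * 'rV[R]_d) : \bar R :=
  ((\1_I z.1)%:E * (u' (z.2 + z.1 *: e))%:E)%E.
have mF : measurable_fun setT F.
  apply: emeasurable_funM; apply/measurable_EFinP.
    by apply: measurableT_comp => //; exact: measurable_indic.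
  apply: (@measurableT_comp _ _ _ _ _ _ u').
    exact: continuous_measurable_rV.
  apply: measurable_fun_rVP => i; under eq_fun do rewrite !mxE.
  apply: measurable_funD.
    exact: (measurableT_comp (measurable_rV_coord i) measurable_snd).
  exact: (measurable_funM measurable_fst (measurable_cst _)).
have mu' := continuous_measurable_rV cu'.
(* By translation invariance every slice with parameter in [0, 1] has the same absolute integral,
   that of |u'|, and [0, 1] has length 1. *)
have absF : (\int[lebesgue_measure]_x \int[lebesgue_rV d]_v `|F (x, v)| < +oo)%E.
  rewrite (_ : (\int[_]_x _)%E = (\int[lebesgue_measure]_x
      ((\1_I x)%:E * \int[lebesgue_rV d]_v `|(u' v)%:E|)))%E; last first.
    apply: eq_integral => x _.
    rewrite -(ge0_integral_rV_shift (x *: e) 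
      (h := fun v => `|(u' v)%:E|%E))//; last first.
      by apply: measurableT_comp => //; exact/measurable_EFinP.
    rewrite -ge0_integralZl//; last first.
      apply: measurableT_comp => //; apply/measurable_EFinP.
      exact: (measurableT_comp mu' (measurable_rVD _)).
    by apply: eq_integral => v _; rewrite /F abseM gee0_abs// lee_fin.
  move/integrableP : iu' => [_ u'oo].
  rewrite ge0_integralZr//; last 2 first.
    exact/measurable_EFinP/measurable_indic.
    exact: integral_ge0.
  by rewrite lI mul1e.
have iF : (lebesgue_measure \x lebesgue_rV d)%E.-integrable setT F.
  exact/integrable12ltyP.
have := Fubini iF.
rewrite [X in X = _ -> _](_ : _ = \int[lebesgue_rV d]_v (u' v)%:E)%E; last first.
  transitivity (\int[lebesgue_measure]_x
      ((\1_I x)%:E * \int[lebesgue_rV d]_v (u' v)%:E))%E.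
    apply: eq_integral => x _; rewrite /F /=.
    rewrite integralZl//; last exact: integrable_rV_shift.
    by rewrite integral_rV_shift.
  have /fineK <- := integrable_fin_num measurableT iu'.
  rewrite integralZr//; last first.
    apply/integrableP; split; first exact/measurable_EFinP/measurable_indic.
    under eq_integral => x _ do rewrite gee0_abs ?lee_fin//.
    by rewrite lI ltry.
  by rewrite lI mul1e.
move=> ->.
transitivity (\int[lebesgue_rV d]_v ((u (v + e)%R)%:E - (u v)%:E))%E.
  apply: eq_integral => v _; rewrite -(integral_line v cu cu' du).
  rewrite [RHS]integral_mkcond; apply: eq_integral => t _.
  by rewrite /F /= patchE indicE; case: ifPn; rewrite ?mul1e ?mul0e.
rewrite integralB_EFin//; last exact: integrable_rV_shift.
rewrite integral_rV_shift; last exact: continuous_measurable_rV.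
by rewrite subee// integrable_fin_num.
Qed.

(** * Hardy's inequality *)

Lemma enorm2 (R : realType) d (v : 'rV[R]_d) :
  enorm v ^+ 2 = \sum_(i < d) v ord0 i ^+ 2.
Proof. by rewrite sqr_sqrtr// sumr_ge0// => i _; rewrite sqr_ge0. Qed.

Lemma sqr_coord_le_enorm2 (R : realType) d (v : 'rV[R]_d) i :
  v ord0 i ^+ 2 <= enorm v ^+ 2.
Proof.
by rewrite enorm2 (bigD1 i)//= lerDl sumr_ge0// => j _; rewrite sqr_ge0.
Qed.

Lemma continuous_coord (R : realType) d (i : 'I_d) :
  continuous (fun v : 'rV[R]_d => v ord0 i).
Proof. exact: coord_continuous. Qed.

Lemma continuous_enorm2 (R : realType) d (w : 'rV[R]_d) :
  continuous (fun v : 'rV[R]_d => enorm (v - w) ^+ 2).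
Proof.
under eq_fun do rewrite enorm2.
apply: (@continuous_big _ _ +%R) => // [|i _ v].
  exact: add_continuous.
under eq_fun do rewrite !mxE.
have h := continuousB (@continuous_coord R d i v)
  (@cst_continuous _ _ (w ord0 i : R) v).
exact: (continuousM h h).
Qed.

Lemma is_derive_coord (R : realType) d (v e : 'rV[R]_d) (j : 'I_d) :
  is_derive v e (fun w : 'rV[R]_d => w ord0 j : R) (e ord0 j).
Proof.
have h : (fun h : R => h^-1 *: (((fun w : 'rV[R]_d => w ord0 j) \o shift v) (h *: e)
    - v ord0 j)) h @[h --> 0^'] --> e ord0 j.
  apply: cvg_near_cst; near=> h => /=.
  rewrite !mxE addrK; rewrite [LHS]mulrA mulVf ?mul1r//.
  by near: h; exact: nbhs_dnbhs_neq.
by split; [apply/cvg_ex; exists (e ord0 j)|exact: cvg_lim].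
Unshelve. all: by end_near. Qed.

Lemma is_derive_mul (R : realType) (V : normedModType R) (f g : V -> R)
    (x v : V) (df dg : R) :
  is_derive x v f df -> is_derive x v g dg ->
  is_derive x v (fun y => f y * g y) (f x * dg + g x * df).
Proof. exact: is_deriveM. Qed.

Lemma is_derive_inv (R : realType) (V : normedModType R) (f : V -> R)
    (x v : V) (df : R) :
  f x != 0 -> is_derive x v f df ->
  is_derive x v (fun y => (f y)^-1) (- (f x) ^- 2 * df).
Proof.
move=> fx0 [dfx <-]; split; first exact: derivableV.
by rewrite deriveV.
Qed.

Lemma is_derive_addr (R : realType) (V : normedModType R) (f : V -> R)
    (x v : V) (df a : R) :
  is_derive x v f df -> is_derive x v (fun y => f y + a) df.
Proof.
move=> h; rewrite -[df]addr0.
exact: (@is_deriveD _ _ _ f (cst a) _ _ _ _ h (is_derive_cst a x v)).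
Qed.

Lemma is_derive_enorm2 (R : realType) d (v w : 'rV[R]_d) (i : 'I_d) :
  is_derive v (delta_mx ord0 i) (fun v : 'rV[R]_d => enorm (v - w) ^+ 2)
    (2 * (v ord0 i - w ord0 i)).
Proof.
under eq_fun do rewrite enorm2.
have h j : is_derive v (delta_mx ord0 i)
    (fun v : 'rV[R]_d => (v - w) ord0 j ^+ 2 : R)
    (2 * (v ord0 j - w ord0 j) * (i == j)%:R).
  under eq_fun do rewrite !mxE.
  have hd := is_derive_addr (- w ord0 j) (is_derive_coord v (delta_mx ord0 i) j).
  apply: is_derive_eq (is_derive_mul hd hd) _.
  by rewrite mxE eqxx/= eq_sym; ring.
have := @is_derive_sum _ _ _ _ _ _ _ _ h.
rewrite (_ : \sum_(i0 < d) _ = 2 * (v ord0 i - w ord0 i)); last first.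
  rewrite (bigD1 i)//= eqxx mulr1 big1 ?addr0// => j /negbTE ji.
  by rewrite eq_sym ji mulr0.
by rewrite (_ : \sum_(i0 < d) _ =
  (fun x : 'rV[R]_d => \sum_(i0 < d) (x - w) ord0 i0 ^+ 2))//
  funeqE => x; rewrite fct_sumE.
Qed.

Section continuous_fun.
Context {R : realType} {T : topologicalType}.
Implicit Types f g : T -> R.

Lemma continuous_funD f g : continuous f -> continuous g ->
  continuous (fun x => f x + g x).
Proof. by move=> cf cg x; exact: (continuousD (cf x) (cg x)). Qed.

Lemma continuous_funB f g : continuous f -> continuous g ->
  continuous (fun x => f x - g x).
Proof. by move=> cf cg x; exact: (continuousB (cf x) (cg x)). Qed.

Lemma continuous_funN f : continuous f -> continuous (fun x => - f x).
Proof. by move=> cf x; exact: (continuousN (cf x)). Qed.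

Lemma continuous_funM f g : continuous f -> continuous g ->
  continuous (fun x => f x * g x).
Proof. by move=> cf cg x; exact: (continuousM (cf x) (cg x)). Qed.

Lemma continuous_funV f : (forall x, f x != 0) -> continuous f ->
  continuous (fun x => (f x)^-1).
Proof. by move=> f0 cf x; exact: (continuousV (f0 x) (cf x)). Qed.

Lemma continuous_sqr f : continuous f -> continuous (fun x => f x ^+ 2).
Proof. by move=> cf; exact: continuous_funM. Qed.

Lemma continuous_const (c : R) : continuous (fun _ : T => c).
Proof. exact: cst_continuous. Qed.

End continuous_fun.

Lemma integrable_dominated (R : realType) d (f h : 'rV[R]_d -> R) :
  continuous f -> (forall v, `|f v| <= h v) ->
  (lebesgue_rV d).-integrable setT (EFin \o h) ->
  (lebesgue_rV d).-integrable setT (EFin \o f).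
Proof.
move=> cf fh; apply: le_integrable => //.
  by apply/measurable_EFinP; exact: continuous_measurable_rV.
by move=> v _ /=; rewrite lee_fin (le_trans (fh v))// ler_norm.
Qed.

(* Integrate the divergence of [g ^ 2 V] with
   [V v = (v - w) / (|v - w| ^ 2 + delta)]; expanding it and completing the
   square gives [2 div (g ^ 2 V) >= g ^ 2 / (|v - w| ^ 2 + delta) - 4 |grad g| ^ 2]
   since [2 d - 5 >= 1]. *)
Lemma hardy_regularized (R : realType) d (g : 'rV[R]_d -> R)
    (g' : 'I_d -> 'rV[R]_d -> R) (w : 'rV[R]_d) (delta : R) :
  (3 <= d)%N -> 0 < delta ->
  continuous g -> (forall i, continuous (g' i)) ->
  (forall i v, is_derive v (delta_mx ord0 i) g (g' i v)) ->
  (lebesgue_rV d).-integrable setT (EFin \o (fun v => g v ^+ 2)) ->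
  (forall i, (lebesgue_rV d).-integrable setT (EFin \o (fun v => g' i v ^+ 2))) ->
  (\int[lebesgue_rV d]_v (g v ^+ 2 / (enorm (v - w)%R ^+ 2 + delta))%:E <=
   4%:E * \sum_(i < d) \int[lebesgue_rV d]_v (g' i v ^+ 2)%:E)%E.
Proof.
move=> d3 dl0 cg cg' dg ig ig'.
pose D (v : 'rV[R]_d) := enorm (v - w) ^+ 2 + delta.
have D0 v : 0 < D v by rewrite ltr_wpDl// sqr_ge0.
have cD : continuous D.
  exact: (continuous_funD (@continuous_enorm2 R d w) (@continuous_const R _ _)).
pose r (v : 'rV[R]_d) := (D v)^-1.
have cr : continuous r by apply: continuous_funV => // v; rewrite gt_eqF.
pose x i (v : 'rV[R]_d) := v ord0 i - w ord0 i.
have cx i : continuous (x i).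
  exact: (continuous_funB (@continuous_coord R d i) (@continuous_const R _ _)).
have dx i v : is_derive v (delta_mx ord0 i) (x i) 1.
  apply: is_derive_addr; apply: is_derive_eq (is_derive_coord _ _ _) _.
  by rewrite mxE !eqxx.
have dr i v : is_derive v (delta_mx ord0 i) r (- 2 * x i v * r v ^+ 2).
  apply: is_derive_eq (is_derive_inv _ (is_derive_addr _ (is_derive_enorm2 v w i))) _.
    by rewrite -/(D v) gt_eqF.
  by rewrite -/(D v) /r /x exprVn; ring.
pose u i v := g v * g v * (x i v * r v).
pose u' i v := g v ^+ 2 * (r v - 2 * x i v ^+ 2 * r v ^+ 2) +
  2 * g v * g' i v * x i v * r v.
have du i v : is_derive v (delta_mx ord0 i) (u i) (u' i v).
  apply: is_derive_eq (is_derive_mul (is_derive_mul (dg i v) (dg i v))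
    (is_derive_mul (dx i v) (dr i v))) _.
  by rewrite /u'; ring.
have r0 v : 0 < r v by rewrite invr_gt0.
have rdl v : r v <= delta^-1.
  by rewrite lef_pV2 ?posrE// lerDr sqr_ge0.
have xr i v : x i v ^+ 2 * r v <= 1.
  rewrite ler_pdivrMr// mul1r /D; apply: ler_wpDr; first exact: ltW.
  have := sqr_coord_le_enorm2 (v - w) i.
  by rewrite !mxE.
(* [c] bounds |x_i r|, because |x_i| <= 1 + x_i^2 while r <= 1/delta and x_i^2 r <= 1. The same
   bounds give domination of [u] and [u'] by [g] squared and its derivatives squared. *)
pose c := 1 + delta^-1.
have xrc i v : `|x i v * r v| <= c.
  have h : `|x i v| <= 1 + x i v ^+ 2.
    rewrite -(real_normK (num_real (x i v))).
    by have := sqr_ge0 (`|x i v| - 1); have := normr_ge0 (x i v); nra.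
  rewrite normrM (gtr0_norm (r0 v)).
  rewrite (le_trans (ler_wpM2r (ltW (r0 v)) h))// mulrDl mul1r addrC /c.
  by rewrite lerD.
have drc i v : `|r v - 2 * x i v ^+ 2 * r v ^+ 2| <= 3 * c.
  have h : 0 <= x i v ^+ 2 * r v by rewrite mulr_ge0// ?sqr_ge0 ?ltW.
  have h1 := xr i v; have h2 := r0 v; have h3 := rdl v.
  rewrite ler_norml /c; apply/andP; split; nra.
have c0 : 0 <= c by rewrite addr_ge0// invr_ge0 ltW.
have cu i : continuous (u i).
  exact: (continuous_funM (continuous_funM cg cg) (continuous_funM (cx i) cr)).
have cu' i : continuous (u' i).
  have cg2 := continuous_sqr cg; have cr2 := continuous_sqr cr.
  have cx2 := continuous_sqr (cx i); have c2 := @continuous_const R 'rV[R]_d 2.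
  apply: continuous_funD.
    apply: continuous_funM => //; apply: continuous_funB => //.
    by apply: continuous_funM => //; exact: continuous_funM.
  do 3 apply: continuous_funM => //; exact: continuous_funM.
have iu i : (lebesgue_rV d).-integrable setT (EFin \o u i).
  apply: (@integrable_dominated _ _ _ (fun v => c * g v ^+ 2)) => // [v|].
    rewrite /u normrM mulrC -expr2 (ger0_norm (sqr_ge0 _)).
    by rewrite ler_wpM2r// sqr_ge0.
  exact: (integrableZl measurableT c ig).
have iu' i : (lebesgue_rV d).-integrable setT (EFin \o u' i).
  apply: (@integrable_dominated _ _ _
    (fun v => 4 * c * g v ^+ 2 + c * g' i v ^+ 2)) => // [v|].
    rewrite /u' (le_trans (ler_normD _ _))//.
    have h1 : `|g v ^+ 2 * (r v - 2 * x i v ^+ 2 * r v ^+ 2)| <= g v ^+ 2 * (3 * c).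
      by rewrite normrM (ger0_norm (sqr_ge0 _)) ler_wpM2l// sqr_ge0.
    have h2 : `|2 * g v * g' i v * x i v * r v| <= (g v ^+ 2 + g' i v ^+ 2) * c.
      rewrite -(mulrA _ (x i v)) normrM ler_pM// ler_norml.
      have := sqr_ge0 (g v + g' i v); have := sqr_ge0 (g v - g' i v).
      by move=> ? ?; apply/andP; split; lra.
    rewrite (le_trans (lerD h1 h2))//; lra.
  rewrite (_ : _ \o _ =
    (fun v => ((4 * c)%:E * (g v ^+ 2)%:E) + (c%:E * (g' i v ^+ 2)%:E))%E)//.
  apply: integrableD => //.
    exact: (integrableZl measurableT _ ig).
  exact: (integrableZl measurableT _ (ig' i)).
have u'0 i : (\int[lebesgue_rV d]_v (u' i v)%:E = 0)%E.
  exact: (integral_deriv_eq0 (cu i) (cu' i) (du i)).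
(* The squares x_i^2 sum to D - delta, so the intermediate sum equals g^2 ((2 d - 5) r + 5 delta
   r^2), which is at least g^2 r. Its i-th term differs from the final one by the square of g x_i r
   + 2 g'_i. *)
have ptw v : g v ^+ 2 / D v <= \sum_(i < d) (2 * u' i v + 4 * g' i v ^+ 2).
  apply: (@le_trans _ _ (\sum_(i < d)
      g v ^+ 2 * (2 * r v - 5 * x i v ^+ 2 * r v ^+ 2))).
    rewrite -mulr_sumr ler_wpM2l ?sqr_ge0//.
    rewrite sumrB sumr_const card_ord -mulr_suml -mulr_sumr.
    have -> : \sum_(i < d) x i v ^+ 2 = D v - delta.
      rewrite /D addrK enorm2; apply: eq_bigr => i _.
      by rewrite !mxE.
    rewrite expr2 mulrA -(mulrA 5) mulrBl mulfV ?gt_eqF// -/(r v) -mulr_natr.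
    have : 3 <= d%:R :> R by rewrite (ler_nat _ 3).
    have := r0 v; have : 0 <= delta * r v by rewrite mulr_ge0// ltW.
    nra.
  apply: ler_sum => i _; rewrite /u' -subr_ge0.
  set lhs := (X in 0 <= X).
  have -> : lhs = (g v * x i v * r v + 2 * g' i v) ^+ 2 by rewrite /lhs; ring.
  exact: sqr_ge0.
have i2 i : (lebesgue_rV d).-integrable setT
    (fun v => (2 * u' i v + 4 * g' i v ^+ 2)%:E).
  rewrite (_ : (fun _ => _) =
    (fun v => (2%:E * (u' i v)%:E) + (4%:E * (g' i v ^+ 2)%:E))%E)//.
  apply: integrableD => //.
    exact: (integrableZl measurableT _ (iu' i)).
  exact: (integrableZl measurableT _ (ig' i)).
have mi i := measurable_int _ (i2 i).
apply: (@le_trans _ _ (\int[lebesgue_rV d]_v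
    \sum_(i < d) (2 * u' i v + 4 * g' i v ^+ 2)%:E)%E).
  apply: ge0_le_integral => //.
  - by move=> v _; rewrite lee_fin; exact: (mulr_ge0 (sqr_ge0 _) (ltW (r0 v))).
  - apply/measurable_EFinP; apply: continuous_measurable_rV.
    exact: (continuous_funM (continuous_sqr cg) cr).
  - by apply: emeasurable_sum => i.
  - by move=> v _; rewrite sumEFin lee_fin.
rewrite integral_sum// ge0_sume_distrr; last first.
  by move=> i _; apply: integral_ge0 => v _; rewrite lee_fin sqr_ge0.
apply: lee_sum => i _.
under eq_integral do rewrite EFinD.
rewrite integralD//; last 2 first.
  exact: (integrableZl measurableT _ (iu' i)).
  exact: (integrableZl measurableT _ (ig' i)).
under eq_integral do rewrite EFinM.
rewrite integralZl//; last exact: iu'.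
rewrite u'0 mule0 add0e.
under eq_integral do rewrite EFinM.
by rewrite integralZl//; exact: ig'.
Qed.

(** On nonnegative reals the inverse is the power of exponent -1, including at 0, where both are
    0. *)
Lemma measurable_fun_inv (R : realType) disp (T : measurableType disp)
    (f : T -> R) :
  (forall x, 0 <= f x) -> measurable_fun setT f ->
  measurable_fun setT (fun x => (f x)^-1).
Proof.
move=> f0 mf; under eq_fun do rewrite -powR_inv1//.
exact: (measurableT_comp (measurable_powR (- 1)) mf).
Qed.

(** The regularised bound is uniform in delta; take delta = 1/(n+1) and let n tend to infinity by
    monotone convergence. *)
Lemma hardy (R : realType) d (g : 'rV[R]_d -> R)
    (g' : 'I_d -> 'rV[R]_d -> R) (w : 'rV[R]_d) :
  (3 <= d)%N -> continuous g -> (forall i, continuous (g' i)) ->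
  (forall i v, is_derive v (delta_mx ord0 i) g (g' i v)) ->
  (lebesgue_rV d).-integrable setT (EFin \o (fun v => g v ^+ 2)) ->
  (forall i, (lebesgue_rV d).-integrable setT (EFin \o (fun v => g' i v ^+ 2))) ->
  (\int[lebesgue_rV d]_v (g v ^+ 2 / enorm (v - w)%R ^+ 2)%:E <=
   4%:E * \sum_(i < d) \int[lebesgue_rV d]_v (g' i v ^+ 2)%:E)%E.
Proof.
move=> d3 cg cg' dg ig ig'.
pose f n (v : 'rV[R]_d) : \bar R :=
  (g v ^+ 2 / (enorm (v - w)%R ^+ 2 + n.+1%:R^-1))%:E.
have D0 n v : 0 < enorm (v - w) ^+ 2 + n.+1%:R^-1 :> R.
  by rewrite ltr_wpDl// sqr_ge0.
have mf n : measurable_fun setT (f n).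
  apply/measurable_EFinP; apply: continuous_measurable_rV.
  apply: continuous_funM; first exact: continuous_sqr.
  apply: continuous_funV; first by move=> v; rewrite gt_eqF.
  exact: (continuous_funD (@continuous_enorm2 R d w) (@continuous_const R _ _)).
have f0 n v : (0 <= f n v)%E.
  by rewrite lee_fin mulr_ge0 ?sqr_ge0// invr_ge0 ltW.
have ndf v : nondecreasing_seq (f ^~ v).
  move=> m n mn; rewrite lee_fin ler_wpM2l ?sqr_ge0// lef_pV2 ?posrE//.
  by rewrite lerD2l lef_pV2 ?posrE// ler_nat.
apply: (@le_trans _ _ (\int[lebesgue_rV d]_v limn (f ^~ v))%E).
  apply: ge0_le_integral => //.
  - by move=> v _; rewrite lee_fin mulr_ge0 ?invr_ge0 ?sqr_ge0.
  - apply/measurable_EFinP; apply: measurable_funM.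
      by apply: continuous_measurable_rV; exact: continuous_sqr.
    apply: measurable_fun_inv => [v|]; first exact: sqr_ge0.
    exact: (continuous_measurable_rV (@continuous_enorm2 R d w)).
  - by apply: (emeasurable_fun_cvg f) => // v _; exact/ereal_nondecreasing_is_cvgn.
  move=> v _; have cv := ereal_nondecreasing_is_cvgn (@ndf v).
  (* At v = w division by zero returns 0, so the integrand vanishes and it suffices that the limit
     is nonnegative. *)
  have [S0|S0] := eqVneq (enorm (v - w) ^+ 2) 0.
    by rewrite S0 invr0 mulr0; apply: lime_ge => //; exact: nearW.
  rewrite (_ : limn _ = (g v ^+ 2 / enorm (v - w) ^+ 2)%:E)//.
  apply/cvg_lim => //; apply: cvg_EFin; first exact: nearW.
  apply: cvgM; first exact: cvg_cst.
  apply: cvgV => //; rewrite -[X in _ --> X]addr0.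
  by apply: cvgD; [exact: cvg_cst|exact: cvg_harmonic].
rewrite monotone_convergence//; apply: lime_le.
  apply: ereal_nondecreasing_is_cvgn => m n mn.
  by apply: ge0_le_integral => // v _; exact: ndf.
by apply: nearW => n; apply: hardy_regularized.
Qed.

(** * Gaussian integrals and the chain rule *)

Lemma enorm2_rV_cons (R : realType) n (x : R) (w : 'rV[R]_n) :
  enorm (rV_cons (x, w)) ^+ 2 = x ^+ 2 + enorm w ^+ 2.
Proof.
rewrite !enorm2 (@big_split_ord _ _ _ 1 n) /= big_ord1.
rewrite /rV_cons (@row_mxEl _ 1 1 n) mxE mulr1n; congr (_ + _).
by apply: eq_bigr => i _; rewrite (@row_mxEr _ 1 1 n).
Qed.

Lemma continuous_gauss_rV (R : realType) d :
  continuous (fun v : 'rV[R]_d => expR (- enorm v ^+ 2)).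
Proof.
move=> v; apply: continuous_comp; last exact: continuous_expR.
apply: continuousN; have := @continuous_enorm2 R d 0 v.
by under eq_fun do rewrite subr0.
Qed.

Lemma measurable_gauss_rV (R : realType) d :
  measurable_fun setT (fun v : 'rV[R]_d => (expR (- enorm v ^+ 2))%:E).
Proof.
apply/measurable_EFinP; apply: continuous_measurable_rV.
exact: continuous_gauss_rV.
Qed.

(** The Gaussian factors over the coordinates, so each dimension contributes one factor sqrt pi. In
    dimension 0 the measure is a Dirac mass. *)
Lemma integral_gauss_rV (R : realType) d :
  (\int[lebesgue_rV d]_v (expR (- enorm v ^+ 2))%:E =
   (Num.sqrt pi ^+ d)%:E :> \bar R)%E.
Proof.
elim: d => [|n IH].
  rewrite /= integral_dirac//; last exact: measurable_gauss_rV.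
  by rewrite diracT mul1e enorm2 big_ord0 oppr0 expR0.
rewrite ge0_integral_rVS; last 2 first.
- exact: measurable_gauss_rV.
- by move=> v; rewrite lee_fin expR_ge0.
transitivity (\int[@lebesgue_measure R]_x ((gauss_fun x)%:E * (Num.sqrt pi ^+ n)%:E))%E.
  apply: eq_integral => x _; rewrite -IH -ge0_integralZl//.
  - by apply: eq_integral => w _; rewrite enorm2_rV_cons opprD expRD EFinM.
  - exact: measurable_gauss_rV.
  - by rewrite lee_fin gauss_fun_ge0.
rewrite ge0_integralZr//.
- by rewrite integralT_gauss exprS EFinM.
- by apply/measurable_EFinP; exact: measurable_gauss_fun.
- by move=> x _; rewrite lee_fin gauss_fun_ge0.
Qed.

Lemma is_derive_lineP (R : realType) d (u : 'rV[R]_d -> R) (v e : 'rV[R]_d)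
    (l : R) :
  is_derive (0 : R) 1 (fun s : R => u (v + s *: e)) l -> is_derive v e u l.
Proof.
have E : (fun h : R => h^-1 *: (((fun s => u (v + s *: e)) \o shift 0) (h *: 1) -
      u (v + 0 *: e))) =
    (fun h : R => h^-1 *: ((u \o shift v) (h *: e) - u v)).
  apply/funext => h /=; rewrite scale0r addr0 addr0; congr (_ *: (u _ - _)).
  by rewrite [h *: 1]mulr1 addrC.
move=> [du <-]; split; first by rewrite /derivable -E; exact: du.
by rewrite /derive -E.
Qed.

(** Restricting [u] to the line through [v] with direction [e] reduces this to the one-variable
    chain rule. *)
Lemma is_derive_comp1 (R : realType) d (h : R -> R) (u : 'rV[R]_d -> R)
    (v e : 'rV[R]_d) (dh du : R) :
  is_derive v e u du -> is_derive (u v) 1 h dh ->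
  is_derive v e (fun w => h (u w)) (dh * du).
Proof.
move=> hu hh; apply: is_derive_lineP.
have hu0 : is_derive (0 : R) 1 (fun s : R => u (v + s *: e)) du.
  by apply: is_derive_line; rewrite scale0r addr0.
have hh0 : is_derive (u (v + 0 *: e)) 1 h dh by rewrite scale0r addr0.
exact: (is_derive1_comp hh0 hu0).
Qed.

(** * Uniform integrability *)

(** The negative part of [h] is at most [p], so its integral is finite and at most P; adding it to
    the integral of [h] gives that of the positive part. *)
Lemma integral_posr_le disp (T : measurableType disp) (R : realType)
    (mu : {measure set T -> \bar R}) (h p : T -> R) (K P : R) :
  measurable_fun setT h -> measurable_fun setT p ->
  (forall x, 0 <= p x) -> (forall x, - p x <= h x) ->
  (\int[mu]_x (p x)%:E <= P%:E)%E -> (\int[mu]_x (h x)%:E <= K%:E)%E ->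
  (\int[mu]_x (Num.max (h x) 0)%:E <= (K + P)%:E)%E.
Proof.
move=> mh mp p0 hp ip; rewrite integralE.
set N := (X in (_ - X)%E) => ih.
have NP : (N <= P%:E)%E.
  apply: le_trans ip; apply: ge0_le_integral => //.
  - by apply: measurable_funeneg; exact/measurable_EFinP.
  - exact/measurable_EFinP.
  - move=> x _; rewrite funenegE ge_max -EFinN !lee_fin p0 andbT.
    by rewrite lerNl hp.
have N0 : (0 <= N)%E.
  by apply: integral_ge0 => x _; rewrite funenegE le_max lexx orbT.
have Nfin : N \is a fin_num by rewrite ge0_fin_numE// (le_lt_trans NP)// ltry.
have -> : (\int[mu]_x (Num.max (h x) 0)%:E = \int[mu]_x ((fun x => (h x)%:E)^\+ x))%E.
  by apply: eq_integral => x _; rewrite funeposE EFin_max.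
by rewrite EFinD (le_trans _ (leeD ih NP))// subeK.
Qed.

Lemma integrable_gauss_rV (R : realType) d :
  (lebesgue_rV d).-integrable setT (fun v : 'rV[R]_d => (expR (- enorm v ^+ 2))%:E).
Proof.
apply/integrableP; split; first exact: measurable_gauss_rV.
under eq_integral do rewrite gee0_abs ?lee_fin ?expR_ge0//.
by rewrite integral_gauss_rV ltry.
Qed.

Lemma mul_expRN_le1 (R : realType) (s : R) : s * expR (- s) <= 1.
Proof.
have [s0|s0] := leP 0 s; last first.
  by rewrite (le_trans _ ler01)// mulr_le0_ge0 ?expR_ge0// ltW.
by rewrite expRN ler_pdivrMr ?expR_gt0// mul1r (le_trans _ (expR_ge1Dx _))// lerDr.
Qed.

(* Hardy's inequality for the test function [w |-> exp (- |w| ^ 2)]. *)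
Lemma gauss_potential_le (R : realType) d (v : 'rV[R]_d) : (3 <= d)%N ->
  (\int[lebesgue_rV d]_w (expR (- enorm w ^+ 2) ^+ 2 / enorm (w - v)%R ^+ 2)%:E <=
   (16 * d%:R * Num.sqrt pi ^+ d)%:E)%E.
Proof.
move=> d3.
pose g (w : 'rV[R]_d) := expR (- enorm w ^+ 2).
pose g' i (w : 'rV[R]_d) := g w * (- 2 * w ord0 i).
have cg : continuous g := @continuous_gauss_rV R d.
have cg' i : continuous (g' i).
  apply: (continuous_funM cg); apply: (continuous_funM (@continuous_const R _ _)).
  exact: continuous_coord.
have dg i w : is_derive w (delta_mx ord0 i) g (g' i w).
  have := is_derive_enorm2 w 0 i.
  rewrite mxE subr0; under eq_fun do rewrite subr0.
  move=> /is_deriveN h; rewrite /g' mulNr.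
  by apply: (is_derive_comp1 h); exact: is_derive_expR.
have g0 w : 0 <= g w by rewrite expR_ge0.
have ggauss w : g w ^+ 2 <= expR (- enorm w ^+ 2).
  rewrite expr2 -[leRHS]mulr1 ler_wpM2l//.
  by rewrite /g -[leRHS]expR0 ler_expR oppr_le0 sqr_ge0.
(* The square is 4 (w_i^2 g) g, and w_i^2 g <= 1 because s exp (-s) <= 1. *)
have g'gauss i w : g' i w ^+ 2 <= 4 * expR (- enorm w ^+ 2).
  have h := mul_expRN_le1 (enorm w ^+ 2); have h1 := sqr_coord_le_enorm2 w i.
  rewrite -/(g w) in h *.
  have : w ord0 i ^+ 2 * g w <= 1 by rewrite (le_trans _ h)// ler_wpM2r.
  rewrite /g'; have := g0 w; nra.
have ig : (lebesgue_rV d).-integrable setT (EFin \o (fun v => g v ^+ 2)).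
  apply: (integrable_dominated _ _ (@integrable_gauss_rV R d)).
    exact: continuous_sqr.
  by move=> w; rewrite ger0_norm ?sqr_ge0.
have ig' i : (lebesgue_rV d).-integrable setT (EFin \o (fun v => g' i v ^+ 2)).
  apply: (@integrable_dominated _ _ _ (fun w => 4 * expR (- enorm w ^+ 2))).
  - exact: continuous_sqr.
  - by move=> w; rewrite ger0_norm ?sqr_ge0.
  - exact: (integrableZl measurableT 4 (@integrable_gauss_rV R d)).
apply: (le_trans (hardy v d3 cg cg' dg ig ig')).
apply: (@le_trans _ _ (4%:E * \sum_(i < d) (4%:E * (Num.sqrt pi ^+ d)%:E))%E).
  rewrite lee_pmul2l// lee_sum// => i _.
  rewrite -integral_gauss_rV -ge0_integralZl//; last first.
    exact: (@measurable_gauss_rV R d).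
  apply: ge0_le_integral => //.
  - by move=> w _; rewrite lee_fin sqr_ge0.
  - exact: (measurable_int _ (ig' i)).
  - exact: (measurable_int _ (integrableZl measurableT 4 (@integrable_gauss_rV R d))).
  - by move=> w _; rewrite -EFinM lee_fin.
rewrite -EFinM sumEFin -EFinM lee_fin sumr_const card_ord -mulr_natr.
by rewrite le_eqVlt; apply/orP; left; apply/eqP; ring.
Qed.

(** Beyond some b the quotient Psi s / s is nonnegative; on the compact interval [0, b] continuity
    provides a minimum. *)
Lemma superlinear_lower_bound (R : realType) (Psi : R -> R) :
  {within `[0, +oo[, continuous Psi} -> Psi r / r @[r --> +oo] --> +oo ->
  exists2 B, 0 <= B & forall s, 0 <= s -> - B <= Psi s.
Proof.
move=> cPsi /cvgryPge/(_ 0)[a [_ ha]].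
pose b := Num.max a 0.
have b0 : 0 <= b by rewrite le_max lexx orbT.
have [c _ hc] : exists2 c, c \in `[0, b]%R &
    forall t, t \in `[0, b]%R -> Psi c <= Psi t.
  apply: EVT_min => //; apply: continuous_subspaceW cPsi.
  by move=> x /=; rewrite !in_itv/= => /andP[->].
exists `|Psi c| => // s s0; have [sb|bs] := leP s b.
  have /hc : s \in `[0, b]%R by rewrite in_itv/= s0.
  by apply: le_trans; rewrite lerNl -normrN ler_norm.
have s_gt0 : 0 < s by exact: le_lt_trans bs.
rewrite (@le_trans _ _ 0)// ?oppr_le0//.
have := ha s; rewrite ler_pdivlMr// mul0r; apply.
by rewrite (le_lt_trans _ bs)// le_max lexx.
Qed.

(** Multiply exp x >= 1 + x at x = - (ln t + a) by t. With a = |v|^2 this controls the negative part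
    of f ln f by the energy density plus a Gaussian. *)
Lemma xlnx_ge (R : realType) (t a : R) : 0 <= t ->
  - (t * a + expR (- a)) <= t * ln t.
Proof.
rewrite le_eqVlt => /predU1P[<-|t0].
  by rewrite !mul0r add0r oppr_le0 expR_ge0.
have := expR_ge1Dx (- (ln t + a)).
rewrite opprD expRD (expRN (ln t)) lnK ?posrE// => h.
have := ler_wpM2l (ltW t0) h.
rewrite mulrA mulfV ?gt_eqF// mul1r; nra.
Qed.

Lemma measurable_enorm2 (R : realType) d :
  measurable_fun setT (fun v : 'rV[R]_d => enorm v ^+ 2).
Proof.
apply: continuous_measurable_rV; have := @continuous_enorm2 R d 0.
by under eq_fun do rewrite subr0.
Qed.

Lemma measurable_Psi_enorm2 (R : realType) d (Psi : R -> R) :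
  {within `[0, +oo[, continuous Psi} ->
  measurable_fun setT (fun v : 'rV[R]_d => Psi (enorm v ^+ 2)).
Proof.
move=> cPsi.
have mP : measurable_fun (`[0, +oo[%classic : set R) Psi.
  exact: subspace_continuous_measurable_fun.
apply: (measurable_comp _ _ mP (@measurable_enorm2 R d)) => //.
by move=> _ [v _ <-] /=; rewrite in_itv/= andbT sqr_ge0.
Qed.

(** [k] and [r] are fixed before [f], which is what makes the final constant uniform. [A] consists
    of the points where f > exp L or |v|^2 > r: large velocities are paid for by [Psi], large values
    of [f] by the entropy. *)
Lemma uniform_integrability (R : realType) d (Psi : R -> R) (M K delta : R) :
  {within `[0, +oo[, continuous Psi} -> Psi r / r @[r --> +oo] --> +oo ->
  0 < delta ->
  exists k r, forall f : 'rV[R]_d -> R,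
    measurable_fun setT f -> (forall v, 0 <= f v) ->
    mass f = 1%E -> energy f = (d%:R)%:E ->
    (m_Psi Psi f <= M%:E)%E -> (entropy f <= K%:E)%E ->
    exists2 A : set 'rV[R]_d, measurable A &
      (forall v, ~ A v -> f v <= k /\ enorm v ^+ 2 <= r) /\
      (\int[lebesgue_rV d]_v (f v * (1 + enorm v ^+ 2) * \1_A v)%:E <= delta%:E)%E.
Proof.
move=> cPsi Psioo delta0.
have [B B0 PsiB] := superlinear_lower_bound cPsi Psioo.
(* Bound for the integral of the positive part of f Psi: the negative part is at most B f, and [f]
   has mass 1. *)
pose P1 : R := `|M| + B.
have P10 : 0 <= P1 by rewrite addr_ge0.
(* The slope is such that (2 / A0) P1 <= delta / 2; the added 1 keeps it positive. *)
pose A0 : R := 4 * (P1 + 1) / delta.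
have A00 : 0 < A0 by rewrite divr_gt0// mulr_gt0// ltr_wpDl.
have /cvgryPge/(_ A0)[a [_ ha]] := Psioo.
(* Beyond [a] the slope [A0] is reached; r >= 1 ensures 1 + |v|^2 <= 2 |v|^2 there. *)
pose r : R := Num.max a 1.
have r1 : 1 <= r by rewrite le_max lexx orbT.
(* Bound for the integral of the positive part of f ln f: to the entropy one adds the energy d and
   the Gaussian integral, which dominate the negative part. *)
pose P2 : R := `|K| + (d%:R + Num.sqrt pi ^+ d).
have P20 : 0 <= P2 by rewrite !addr_ge0// exprn_ge0// sqrtr_ge0.
(* Chosen so that ((1 + r) / L) P2 <= delta / 2, the other half of the budget. *)
pose L : R := 2 * (1 + r) * (P2 + 1) / delta.
have L0 : 0 < L by rewrite divr_gt0// !mulr_gt0// ltr_wpDl//; lra.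
exists (expR L), r => f mf f0 massf energyf mPsif entf.
have mn := @measurable_enorm2 R d.
have mPsi := @measurable_Psi_enorm2 R d Psi cPsi.
have mfPsi := measurable_funM mf mPsi.
have mlnf : measurable_fun setT (fun v => f v * ln (f v)).
  exact: (measurable_funM mf (measurableT_comp (@measurable_ln R) mf)).
have IPsi : (\int[lebesgue_rV d]_v
    (Num.max (f v * Psi (enorm v ^+ 2)) 0)%:E <= P1%:E)%E.
  apply: (@le_trans _ _ (M + B)%:E); last by rewrite lee_fin lerD2r ler_norm.
  apply: (integral_posr_le (p := fun v => B * f v)) => //.
  - exact: measurable_funM.
  - by move=> v; rewrite mulr_ge0.
  - by move=> v; rewrite mulrC -mulrN ler_wpM2l// PsiB// sqr_ge0.
  - under eq_integral do rewrite EFinM.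
    rewrite ge0_integralZl//; first by rewrite -/(mass f) massf mule1.
      exact/measurable_EFinP.
    by move=> v _; rewrite lee_fin.
have Iln : (\int[lebesgue_rV d]_v (Num.max (f v * ln (f v)) 0)%:E <= P2%:E)%E.
  apply: (@le_trans _ _ (K + (d%:R + Num.sqrt pi ^+ d))%:E); last first.
    by rewrite lee_fin lerD2r ler_norm.
  have mg := @measurable_gauss_rV R d.
  apply: (integral_posr_le
    (p := fun v => f v * enorm v ^+ 2 + expR (- enorm v ^+ 2))) => //.
  - by apply: measurable_funD; [exact: measurable_funM|exact/measurable_EFinP].
  - by move=> v; apply: addr_ge0; [rewrite mulr_ge0 ?sqr_ge0|exact: expR_ge0].
  - by move=> v; exact: xlnx_ge.
  - under eq_integral do rewrite EFinD.
    rewrite ge0_integralD//.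
    + by rewrite -/(energy f) energyf integral_gauss_rV -EFinD.
    + by move=> v _; rewrite lee_fin mulr_ge0// sqr_ge0.
    + by apply/measurable_EFinP; exact: measurable_funM.
pose A := ~` ([set v | f v <= expR L] `&` [set v | enorm v ^+ 2 <= r]).
have mA : measurable A.
  apply: measurableC; apply: measurableI.
    rewrite -[X in measurable X]setTI.
    have := mf measurableT `]-oo, expR L]%classic (measurable_itv _).
    by rewrite (_ : f @^-1` _ = [set v | f v <= expR L]).
  rewrite -[X in measurable X]setTI.
  have := mn measurableT `]-oo, r]%classic (measurable_itv _).
  by rewrite (_ : (fun v : 'rV[R]_d => enorm v ^+ 2) @^-1` _ =
    [set v | enorm v ^+ 2 <= r]).
exists A => //; split; first by move=> v /contrapT.
pose c1 : R := 2 / A0; pose c2 : R := (1 + r) / L.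
have c10 : 0 <= c1 by rewrite divr_ge0// ltW.
have c20 : 0 <= c2 by rewrite divr_ge0// ltW//; lra.
have mmax (h : 'rV[R]_d -> R) c : measurable_fun setT h ->
    measurable_fun setT (fun v => (c * Num.max (h v) 0)%:E).
  move=> mh; apply/measurable_EFinP; apply: measurable_funM => //.
  by apply: measurable_maxr.
apply: (@le_trans _ _ (\int[lebesgue_rV d]_v
   ((c1 * Num.max (f v * Psi (enorm v ^+ 2)) 0)%:E +
    (c2 * Num.max (f v * ln (f v)) 0)%:E))%E).
  apply: ge0_le_integral => //.
  - by move=> v _; rewrite lee_fin mulr_ge0 ?mulr_ge0 ?addr_ge0 ?sqr_ge0.
  - apply/measurable_EFinP; apply: measurable_funM; last exact: measurable_indic.
    by apply: measurable_funM => //; exact: measurable_funD.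
  - by apply: emeasurable_funD; exact: mmax.
  move=> v _; rewrite -EFinD lee_fin.
  have m1 : 0 <= Num.max (f v * Psi (enorm v ^+ 2)) 0 by rewrite le_max lexx orbT.
  have m2 : 0 <= Num.max (f v * ln (f v)) 0 by rewrite le_max lexx orbT.
  rewrite indicE; have [/set_mem Av|_] := boolP (v \in A); last first.
    by rewrite mulr0 addr_ge0// mulr_ge0.
  (* On [A] with |v|^2 <= r the value of [f] exceeds exp L, so 1 + |v|^2 <= ((1 + r) / L) ln f.
     Otherwise 1 + |v|^2 <= 2 |v|^2 <= (2 / A0) Psi. *)
  rewrite mulr1; have [nr|rn] := leP (enorm v ^+ 2) r.
    have kf : expR L < f v by rewrite ltNge; apply/negP => fk; apply: Av.
    have fv0 : 0 < f v by rewrite (lt_trans _ kf)// expR_gt0.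
    have Lf : L <= ln (f v) by rewrite -[L]expRK ler_ln ?posrE ?expR_gt0// ltW.
    apply: (@le_trans _ _ (c2 * Num.max (f v * ln (f v)) 0)); last first.
      by rewrite lerDr mulr_ge0.
    apply: (@le_trans _ _ (c2 * (f v * L))).
      rewrite /c2 (_ : _ / L * _ = f v * (1 + r)); last by field; rewrite gt_eqF.
      by rewrite ler_wpM2l// lerD2l.
    by rewrite ler_wpM2l// le_max ler_wpM2l.
  have n0 : 0 < enorm v ^+ 2 by rewrite (lt_trans _ rn)// (lt_le_trans ltr01).
  have hPsi : A0 * enorm v ^+ 2 <= Psi (enorm v ^+ 2).
    rewrite -ler_pdivlMr//; apply: ha; rewrite (le_lt_trans _ rn)//.
    by rewrite le_max lexx.
  apply: (@le_trans _ _ (c1 * Num.max (f v * Psi (enorm v ^+ 2)) 0)); last first.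
    by rewrite lerDl mulr_ge0.
  apply: (@le_trans _ _ (c1 * (f v * (A0 * enorm v ^+ 2)))).
    rewrite /c1 (_ : _ / A0 * _ = f v * (2 * enorm v ^+ 2)); last first.
      by field; rewrite gt_eqF.
    rewrite ler_wpM2l// mulr_natl mulr2n lerD2r.
    by rewrite (le_trans r1)// ltW.
  by rewrite ler_wpM2l// le_max ler_wpM2l.
rewrite ge0_integralD//; last 4 first.
- by move=> v _; rewrite lee_fin mulr_ge0// le_max lexx orbT.
- exact: mmax.
- by move=> v _; rewrite lee_fin mulr_ge0// le_max lexx orbT.
- exact: mmax.
have mmaxE (h : 'rV[R]_d -> R) : measurable_fun setT h ->
    measurable_fun setT (fun v => (Num.max (h v) 0)%:E).
  by move=> mh; apply/measurable_EFinP; apply: measurable_maxr.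
under eq_integral do rewrite EFinM.
under [X in (_ + X)%E]eq_integral do rewrite EFinM.
rewrite !ge0_integralZl//; last 4 first.
- exact: mmaxE.
- by move=> v _; rewrite lee_fin le_max lexx orbT.
- exact: mmaxE.
- by move=> v _; rewrite lee_fin le_max lexx orbT.
apply: (@le_trans _ _ (c1%:E * P1%:E + c2%:E * P2%:E)%E).
  by apply: leeD; apply: lee_wpmul2l.
rewrite -!EFinM -EFinD lee_fin /c1 /c2 /A0 /L.
rewrite [leLHS](_ : _ = (P1 / (P1 + 1) + P2 / (P2 + 1)) * (delta / 2)); last first.
  by field; rewrite !gt_eqF//; lra.
have h1 : P1 / (P1 + 1) <= 1 by rewrite ler_pdivrMr ?mul1r ?lerDl// ltr_wpDl.
have h2 : P2 / (P2 + 1) <= 1 by rewrite ler_pdivrMr ?mul1r ?lerDl// ltr_wpDl.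
nra.
Qed.

(** * The weighted potential *)

Lemma enormB (R : realType) d (v w : 'rV[R]_d) : enorm (v - w) = enorm (w - v).
Proof.
rewrite /enorm; congr Num.sqrt; apply: eq_bigr => i _.
by rewrite !mxE -sqrrN opprB.
Qed.

Lemma measurable_enorm2_sub (R : realType) d :
  measurable_fun setT (fun z : 'rV[R]_d * 'rV[R]_d => enorm (z.1 - z.2) ^+ 2).
Proof.
under eq_fun do rewrite enorm2.
apply: measurable_sum => i; under eq_fun do rewrite !mxE.
apply: measurable_funX; apply: measurable_funB.
  exact: (measurableT_comp (measurable_rV_coord i) measurable_fst).
exact: (measurableT_comp (measurable_rV_coord i) measurable_snd).
Qed.

(** Coordinatewise, the difference of the two sides without the constants is the square of v_i - 2
    w_i. *)
Lemma peetre2 (R : realType) d (v w : 'rV[R]_d) :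
  1 + enorm v ^+ 2 <= 2 * enorm (v - w) ^+ 2 + 2 * (1 + enorm w ^+ 2).
Proof.
have : enorm v ^+ 2 <= 2 * enorm (v - w) ^+ 2 + 2 * enorm w ^+ 2.
  rewrite !enorm2 !mulr_sumr -big_split/= ler_sum// => i _.
  rewrite !mxE; have := sqr_ge0 (v ord0 i - 2 * w ord0 i); nra.
lra.
Qed.

Ltac nonneg :=
  repeat first [exact: sqr_ge0 | by [] | apply: mulr_ge0 | apply: addr_ge0].

(** After [peetre2] three terms remain: the mass of [f], the potential of a Gaussian that dominates
    the part off [A], and the part on [A], which Hardy's inequality turns into [delta] times the
    Dirichlet integral. *)
Lemma weighted_potential_le (R : realType) d (f : 'rV[R]_d -> R)
    (A : set 'rV[R]_d) (k r delta : R) (g : 'rV[R]_d -> R)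
    (g' : 'I_d -> 'rV[R]_d -> R) :
  (3 <= d)%N ->
  measurable_fun setT f -> (forall v, 0 <= f v) -> mass f = 1%E ->
  measurable A ->
  (forall v, ~ A v -> f v <= k /\ enorm v ^+ 2 <= r) ->
  (\int[lebesgue_rV d]_v (f v * (1 + enorm v ^+ 2) * \1_A v)%:E <= delta%:E)%E ->
  continuous g -> (forall i, continuous (g' i)) ->
  (forall i v, is_derive v (delta_mx ord0 i) g (g' i v)) ->
  (lebesgue_rV d).-integrable setT (EFin \o (fun v => g v ^+ 2)) ->
  (forall i, (lebesgue_rV d).-integrable setT (EFin \o (fun v => g' i v ^+ 2))) ->
  (\int[lebesgue_rV d]_v ((g v ^+ 2 * (1 + enorm v ^+ 2))%:E *
     \int[lebesgue_rV d]_w (f w / enorm (v - w)%R ^+ 2)%:E) <=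
   (8 * delta)%:E * (\sum_(i < d) \int[lebesgue_rV d]_v (g' i v ^+ 2)%:E) +
   (2 + 2 * (`|k| * (1 + `|r|) * expR r ^+ 2) * (16 * d%:R * Num.sqrt pi ^+ d))%:E *
     \int[lebesgue_rV d]_v (g v ^+ 2)%:E)%E.
Proof.
move=> d3 mf f0 massf mA kr Idelta cg cg' dg ig ig'.
set S := (\sum_(i < d) _)%E.
have S0 : (0 <= S)%E.
  by apply: sume_ge0 => i _; apply: integral_ge0 => v _; rewrite lee_fin sqr_ge0.
(* Off [A] one has f (1 + |w|^2) <= k (1 + r) and exp (2 r - 2 |w|^2) >= 1. The absolute values make
   [c1] nonnegative whatever the signs of [k] and [r]. *)
set c1 : R := `|k| * (1 + `|r|) * expR r ^+ 2.
have c10 : 0 <= c1 by rewrite !mulr_ge0 ?addr_ge0 ?sqr_ge0.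
pose T (z : 'rV[R]_d * 'rV[R]_d) := (enorm (z.1 - z.2) ^+ 2)^-1.
have T0 z : 0 <= T z by rewrite invr_ge0 sqr_ge0.
have mT : measurable_fun setT T.
  by apply: measurable_fun_inv => [z|]; [exact: sqr_ge0|exact: measurable_enorm2_sub].
have mTv v : measurable_fun setT (fun w => T (v, w)).
  exact: (measurableT_comp mT (pair1_measurable v)).
have mTw w : measurable_fun setT (fun v => T (v, w)).
  exact: (measurableT_comp mT (pair2_measurable w)).
have mn := @measurable_enorm2 R d.
have mg := continuous_measurable_rV cg.
have mg2 := continuous_measurable_rV (continuous_sqr cg).
pose gam (w : 'rV[R]_d) := expR (- enorm w ^+ 2).
have mgam2 : measurable_fun setT (fun w => gam w ^+ 2).
  exact: (continuous_measurable_rV (continuous_sqr (@continuous_gauss_rV R d))).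
pose F (w : 'rV[R]_d) := f w * (1 + enorm w ^+ 2) * \1_A w.
have mF : measurable_fun setT F.
  apply: measurable_funM; last exact: measurable_indic.
  by apply: measurable_funM => //; exact: measurable_funD.
have F0 w : 0 <= F w by rewrite mulr_ge0 ?mulr_ge0 ?addr_ge0 ?sqr_ge0.
have fF w : f w * (1 + enorm w ^+ 2) <= c1 * gam w ^+ 2 + F w.
  rewrite /F indicE; have [_|/negP wA] := boolP (w \in A).
    by rewrite mulr1 lerDr mulr_ge0// sqr_ge0.
  have [fk nr] : f w <= k /\ enorm w ^+ 2 <= r by apply: kr => /mem_set.
  rewrite mulr0 addr0 /c1 -[leRHS]mulrA -exprMn -expRD.
  have k0 := le_trans (f0 w) fk; have r0 := le_trans (sqr_ge0 _) nr.
  rewrite !ger0_norm//; apply: (@le_trans _ _ (k * (1 + r))).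
    by rewrite ler_pM ?addr_ge0 ?sqr_ge0// lerD2l.
  rewrite ler_peMr ?mulr_ge0 ?addr_ge0//.
  by rewrite exprn_ege1// -expR0 ler_expR subr_ge0.
have mfT v : measurable_fun setT (fun w => (f w * T (v, w))%:E).
  by apply/measurable_EFinP; exact: measurable_funM.
have inner v : ((g v ^+ 2 * (1 + enorm v ^+ 2))%:E *
     \int[lebesgue_rV d]_w (f w / enorm (v - w)%R ^+ 2)%:E <=
   (2 + 2 * c1 * (16 * d%:R * Num.sqrt pi ^+ d))%:E * (g v ^+ 2)%:E +
   2%:E * \int[lebesgue_rV d]_w (g v ^+ 2 * F w * T (v, w))%:E)%E.
  rewrite -ge0_integralZl//; last 3 first.
    exact: (mfT v).
    by move=> w _; rewrite lee_fin (mulr_ge0 (f0 w) (T0 (v, w))).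
    by rewrite lee_fin mulr_ge0 ?addr_ge0 ?sqr_ge0.
  have m1 : measurable_fun setT (fun w => (2 * g v ^+ 2 * f w)%:E).
    by apply/measurable_EFinP; exact: measurable_funM.
  have m2 : measurable_fun setT
      (fun w => (2 * g v ^+ 2 * c1 * (gam w ^+ 2 * T (v, w)))%:E).
    by apply/measurable_EFinP; do 2 apply: measurable_funM => //.
  have m3 : measurable_fun setT (fun w => (g v ^+ 2 * F w * T (v, w))%:E).
    by apply/measurable_EFinP; do 2 apply: measurable_funM => //.
  have m3' : measurable_fun setT (fun w => (2 * (g v ^+ 2 * F w * T (v, w)))%:E).
    by apply/measurable_EFinP; apply: measurable_funM => //; exact/measurable_EFinP.
  have p1 w : (0 <= (2 * g v ^+ 2 * f w)%:E)%E by rewrite lee_fin; nonneg.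
  have p2 w : (0 <= (2 * g v ^+ 2 * c1 * (gam w ^+ 2 * T (v, w)))%:E)%E.
    by rewrite lee_fin; nonneg.
  have p3 w : (0 <= (g v ^+ 2 * F w * T (v, w))%:E)%E by rewrite lee_fin; nonneg.
  have p3' w : (0 <= (2 * (g v ^+ 2 * F w * T (v, w)))%:E)%E.
    by rewrite lee_fin; nonneg.
  apply: (@le_trans _ _ (\int[lebesgue_rV d]_w ((2 * g v ^+ 2 * f w)%:E +
    ((2 * g v ^+ 2 * c1 * (gam w ^+ 2 * T (v, w)))%:E +
    (2 * (g v ^+ 2 * F w * T (v, w)))%:E)))%E).
    apply: ge0_le_integral => //.
    - move=> w _; rewrite -EFinM lee_fin mulr_ge0//.
        by nonneg.
      exact: (mulr_ge0 (f0 w) (T0 (v, w))).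
    - exact: (measurable_funeM _ (mfT v)).
    - by apply: emeasurable_funD => //; exact: emeasurable_funD.
    move=> w _; rewrite -EFinM -!EFinD lee_fin.
    rewrite -[_^-1]/(T (v, w)).
    (* Only an inequality: at v = w the product is 0, since the inverse of 0 is 0. *)
    have h : enorm (v - w) ^+ 2 * T (v, w) <= 1.
      rewrite /T /=; have [->|n0] := eqVneq (enorm (v - w) ^+ 2) 0.
        by rewrite mul0r.
      by rewrite mulfV.
    have h1 := ler_wpM2r (mulr_ge0 (f0 w) (T0 (v, w))) (peetre2 v w).
    have h2 := ler_wpM2l (f0 w) h.
    have h3 := ler_wpM2r (T0 (v, w)) (fF w).
    (* [peetre2] multiplied by f T, with |v - w|^2 T bounded by 1 and f (1 + |w|^2) split by
       [fF]. *)
    have h4 : (1 + enorm v ^+ 2) * (f w * T (v, w)) <=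
        2 * f w + 2 * c1 * (gam w ^+ 2 * T (v, w)) + 2 * (F w * T (v, w)) by nra.
    have := ler_wpM2l (sqr_ge0 (g v)) h4; lra.
  rewrite ge0_integralD//; last 2 first.
    by move=> w _; exact: adde_ge0.
    exact: emeasurable_funD.
  rewrite ge0_integralD//.
  rewrite (_ : (\int[lebesgue_rV d]_w (2 * g v ^+ 2 * f w)%:E)%E =
    (2 * g v ^+ 2)%:E); last first.
    under eq_integral do rewrite EFinM.
    rewrite ge0_integralZl//; first by rewrite -/(mass f) massf mule1.
    - exact/measurable_EFinP.
    - by move=> w _; rewrite lee_fin.
    - by rewrite lee_fin; nonneg.
  rewrite (_ : (\int[lebesgue_rV d]_w (2 * (g v ^+ 2 * F w * T (v, w)))%:E)%E =
    (2%:E * \int[lebesgue_rV d]_w (g v ^+ 2 * F w * T (v, w))%:E)%E); last first.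
    by under eq_integral do rewrite EFinM; rewrite ge0_integralZl.
  rewrite addeA leeD2r// [X in (_ + X <= _)%E](_ : _ = (2 * g v ^+ 2 * c1)%:E *
      \int[lebesgue_rV d]_w (gam w ^+ 2 / enorm (w - v) ^+ 2)%:E)%E; last first.
    have mgT : measurable_fun setT (fun w => (gam w ^+ 2 * T (v, w))%:E).
      by apply/measurable_EFinP; exact: measurable_funM.
    have gT0 w : (0 <= (gam w ^+ 2 * T (v, w))%:E)%E by rewrite lee_fin; nonneg.
    have k0 : (0 <= (2 * g v ^+ 2 * c1)%:E :> \bar R)%E by rewrite lee_fin; nonneg.
    under eq_integral do rewrite EFinM.
    rewrite (ge0_integralZl _ measurableT mgT (fun w _ => gT0 w) k0).
    have TE w : T (v, w) = (enorm (w - v) ^+ 2)^-1 by rewrite /T /= enormB.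
    by under eq_integral do rewrite TE.
  apply: (@le_trans _ _ ((2 * g v ^+ 2)%:E + (2 * g v ^+ 2 * c1)%:E *
     (16 * d%:R * Num.sqrt pi ^+ d)%:E)%E).
    rewrite leeD2l// lee_wpmul2l//; first by rewrite lee_fin; nonneg.
    exact: gauss_potential_le.
  by rewrite -!EFinM -EFinD lee_fin le_eqVlt; apply/orP; left; apply/eqP; ring.
pose G (z : 'rV[R]_d * 'rV[R]_d) := (g z.1 ^+ 2 * F z.2 * T z)%:E.
have mG : measurable_fun setT G.
  apply/measurable_EFinP; apply: measurable_funM => //; apply: measurable_funM.
    exact: (measurableT_comp mg2 measurable_fst).
  exact: (measurableT_comp mF measurable_snd).
have G0 z : (0 <= G z)%E by rewrite lee_fin; nonneg.
have m4 : measurable_fun setT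
    (fun v => \int[lebesgue_rV d]_w (g v ^+ 2 * F w * T (v, w))%:E)%E.
  exact: (measurable_fun_fubini_tonelli_F G).
have m5 : measurable_fun setT (fun v => \int[lebesgue_rV d]_w (f w * T (v, w))%:E)%E.
  apply: (measurable_fun_fubini_tonelli_F (fun z => (f z.2 * T z)%:E)) => //.
    apply/measurable_EFinP; apply: measurable_funM => //.
    exact: (measurableT_comp mf measurable_snd).
  by move=> z; rewrite lee_fin; nonneg.
(* Tonelli puts the integral in [v] inside; Hardy with [w] frozen bounds it by 4 S uniformly in [w],
   and [F] has integral at most [delta]. *)
have outer : (\int[lebesgue_rV d]_v
    \int[lebesgue_rV d]_w (g v ^+ 2 * F w * T (v, w))%:E <=
    (4 * delta)%:E * S)%E.
  rewrite (fubini_tonelli G)//.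
  apply: (@le_trans _ _ (\int[lebesgue_rV d]_w ((F w)%:E * (4%:E * S)))%E).
    apply: ge0_le_integral; first exact: measurableT.
    - by move=> w _; apply: integral_ge0 => v _; exact: G0.
    - exact: (measurable_fun_fubini_tonelli_G G).
    - by apply: emeasurable_funM => //; exact/measurable_EFinP.
    move=> w _; rewrite (_ : (\int[_]_v _)%E = ((F w)%:E *
      \int[lebesgue_rV d]_v (g v ^+ 2 / enorm (v - w) ^+ 2)%:E)%E); last first.
      rewrite -ge0_integralZl//.
      - apply: eq_integral => v _.
        by rewrite -EFinM [in RHS]mulrA [in RHS](mulrC (F w)).
      - by apply/measurable_EFinP; exact: (measurable_funM mg2 (mTw w)).
      - by move=> v _; rewrite lee_fin; apply: mulr_ge0; rewrite ?invr_ge0; nonneg.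
      - by rewrite lee_fin.
    rewrite lee_wpmul2l// ?lee_fin//.
    exact: hardy.
  rewrite ge0_integralZr//; last 3 first.
  - exact/measurable_EFinP.
  - by move=> w _; rewrite lee_fin.
  - by rewrite mule_ge0.
  apply: (@le_trans _ _ (delta%:E * (4%:E * S))%E).
    by rewrite lee_wpmul2r// mule_ge0.
  by rewrite muleA -EFinM mulrC.
apply: (@le_trans _ _ (\int[lebesgue_rV d]_v
   ((2 + 2 * c1 * (16 * d%:R * Num.sqrt pi ^+ d))%:E * (g v ^+ 2)%:E +
   2%:E * \int[lebesgue_rV d]_w (g v ^+ 2 * F w * T (v, w))%:E))%E).
  apply: ge0_le_integral => //.
  - move=> v _; rewrite mule_ge0//.
      by rewrite lee_fin; nonneg.
    by apply: integral_ge0 => w _; rewrite lee_fin mulr_ge0// invr_ge0 sqr_ge0.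
  - apply: emeasurable_funM => //; apply/measurable_EFinP.
    by apply: measurable_funM => //; exact: measurable_funD.
  - apply: emeasurable_funD; last exact: measurable_funeM.
    by apply: measurable_funeM; exact/measurable_EFinP.
have C0 : 0 <= 2 + 2 * c1 * (16 * d%:R * Num.sqrt pi ^+ d).
  by rewrite addr_ge0// !mulr_ge0// exprn_ge0// sqrtr_ge0.
rewrite ge0_integralD//; last 4 first.
- by move=> v _; rewrite -EFinM lee_fin; nonneg.
- by apply: measurable_funeM; exact/measurable_EFinP.
- move=> v _; rewrite mule_ge0//; apply: integral_ge0 => w _.
  exact: (G0 (v, w)).
- exact: measurable_funeM.
rewrite !ge0_integralZl//; last 3 first.
- by move=> v _; apply: integral_ge0 => w _; exact: (G0 (v, w)).
- exact/measurable_EFinP.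
- by move=> v _; rewrite lee_fin sqr_ge0.
rewrite addeC leeD2r//.
apply: (@le_trans _ _ (2%:E * ((4 * delta)%:E * S))%E).
  by rewrite lee_pmul2l.
by rewrite muleA -EFinM mulrA -natrM.
Qed.

(** * The weight 1/<v> and the proof of the estimate *)

Lemma bracket_gt0 (R : realType) d (v : 'rV[R]_d) : 0 < bracket v.
Proof. by rewrite sqrtr_gt0 ltr_pwDl// sqr_ge0. Qed.

Lemma bracket2 (R : realType) d (v : 'rV[R]_d) : bracket v ^+ 2 = 1 + enorm v ^+ 2.
Proof. by rewrite sqr_sqrtr// addr_ge0// sqr_ge0. Qed.

Lemma continuous_bracketV (R : realType) d :
  continuous (fun v : 'rV[R]_d => (bracket v)^-1).
Proof.
apply: continuous_funV => [v|]; first by rewrite gt_eqF// bracket_gt0.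
move=> v.
apply: (@continuous_comp _ _ _ (fun v : 'rV[R]_d => 1 + enorm v ^+ 2)
  (@Num.sqrt R)); last exact: sqrt_continuous.
apply: continuousD; first exact: cst_continuous.
by have := @continuous_enorm2 R d 0 v; under eq_fun do rewrite subr0.
Qed.

Lemma is_derive_bracketV (R : realType) d (v : 'rV[R]_d) i :
  is_derive v (delta_mx ord0 i) (fun v : 'rV[R]_d => (bracket v)^-1)
    (- (bracket v)^-1 ^+ 3 * v ord0 i).
Proof.
have b0 := bracket_gt0 v.
have h1 : is_derive v (delta_mx ord0 i) (fun v : 'rV[R]_d => 1 + enorm v ^+ 2)
    (2 * v ord0 i).
  under eq_fun do rewrite addrC; apply: is_derive_addr.
  have := is_derive_enorm2 v 0 i.
  by rewrite mxE subr0; under eq_fun do rewrite subr0.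
have h2 : is_derive (1 + enorm v ^+ 2) 1 (@Num.sqrt R) (2 * bracket v)^-1.
  by apply: is_derive1_sqrt; rewrite -bracket2 exprn_gt0.
apply: is_derive_eq (is_derive_inv _ (is_derive_comp1 h1 h2)) _.
  by rewrite gt_eqF.
by rewrite -/(bracket v); field; rewrite gt_eqF.
Qed.

(** [G] is an integrand depending on the point and on the value of the function there. This form
    transfers mass, energy, entropy, [m_Psi] and the potential from [f] to its positive part. *)
Lemma ae_eq_integral_comp disp (T : measurableType disp) (R : realType)
    (mu : {measure set T -> \bar R}) (f h : T -> R) (G : T -> R -> R) :
  {ae mu, forall x, f x = h x} ->
  measurable_fun setT (fun x => G x (f x)) ->
  measurable_fun setT (fun x => G x (h x)) ->
  (\int[mu]_x (G x (f x))%:E = \int[mu]_x (G x (h x))%:E)%E.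
Proof.
move=> fh mf mh; apply: ae_eq_integral => //; try exact/measurable_EFinP.
by apply: filterS fh => x /= -> _.
Qed.

Theorem proposition2p2 (R : realType) (d : nat) (gamma : R) (Psi : R -> R)
    (eps N M K : R) (hd : (3 <= d)%N) (hgamma : gamma = - 2)
    (hPsi : {within `[0, +oo[, continuous Psi})
    (hPsi_oo : Psi r / r @[r --> +oo] --> +oo)
    (heps : 0 < eps) :
  exists2 C : R, 0 < C &
  forall fin f : 'rV[R]_d -> R,
    ae_nonneg fin -> in_Lps 1 2 fin -> in_LlogL fin ->
    mass fin = 1%E -> (forall i, momentum fin i = 0%E) ->
    energy fin = (d%:R)%:E ->
    class_Y0 fin f ->
    wnorm 1 2 f = N%:E ->
    (m_Psi Psi f <= M%:E)%E ->
    (entropy f <= K%:E)%E ->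
  forall phi : 'rV[R]_d -> R, smooth phi ->
    (- (\int[lebesgue_rV d]_v ((phi v ^+ 2)%:E * c_coef gamma f v)) <=
     eps%:E * (\int[lebesgue_rV d]_v
       (enorm (grad (fun w => bracket w `^ (gamma / 2) * phi w) v) ^+ 2)%:E) +
     C%:E * (\int[lebesgue_rV d]_v (phi v ^+ 2 * bracket v `^ gamma)%:E))%E.
Proof.
have d3 : 3 <= d%:R :> R by rewrite (ler_nat _ 3).
(* The factor (d - 1) (gamma + d) of the coefficient at gamma = -2. *)
pose a : R := (d%:R - 1) * (d%:R - 2).
have a0 : 0 < a by rewrite mulr_gt0//; lra.
(* Makes a (8 delta), the final factor of the Dirichlet integral, equal to [eps]. *)
pose delta : R := eps / (8 * a).
have delta0 : 0 < delta by rewrite divr_gt0// mulr_gt0.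
have [k [r unif]] := @uniform_integrability R d Psi M K delta hPsi hPsi_oo delta0.
pose C1 : R := 2 + 2 * (`|k| * (1 + `|r|) * expR r ^+ 2) *
  (16 * d%:R * Num.sqrt pi ^+ d).
have C10 : 0 < C1.
  by rewrite ltr_pwDl// !mulr_ge0 ?addr_ge0 ?exprn_ge0 ?sqrtr_ge0 ?expR_ge0.
exists (a * C1); first exact: mulr_gt0.
move=> fin f _ _ _ massfin _ energyfin [f_ge0 [mf _] [massf _ energyf] _] _.
move=> mPsif entf phi sphi.
(* [f] is nonnegative only almost everywhere; its positive part is so everywhere and has the same
   integrals. *)
pose fp v := Num.max (f v) 0.
have fp0 v : 0 <= fp v by rewrite le_max lexx orbT.
have mfp : measurable_fun setT fp by exact: measurable_maxr.
have ffp : {ae lebesgue_rV d, forall v, f v = fp v}.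
  by apply: filterS f_ge0 => v fv; rewrite /fp; apply/esym/max_idPl.
have mn := @measurable_enorm2 R d.
have massfp : mass fp = 1%E.
  by rewrite -massfin -massf; apply/esym/(ae_eq_integral_comp (G := fun=> id)).
have energyfp : energy fp = (d%:R)%:E.
  rewrite -energyfin -energyf.
  apply/esym/(ae_eq_integral_comp (G := fun v t => t * enorm v ^+ 2)) => //;
    exact: measurable_funM.
have mPsi : measurable_fun setT (fun v : 'rV[R]_d => Psi (enorm v ^+ 2)).
  exact: measurable_Psi_enorm2.
have mPsifp : (m_Psi Psi fp <= M%:E)%E.
  rewrite (le_trans _ mPsif)// le_eqVlt; apply/orP; left; apply/eqP/esym.
  apply: (ae_eq_integral_comp (G := fun v t => t * Psi (enorm v ^+ 2))) => //;
    exact: measurable_funM.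
have mln (h : 'rV[R]_d -> R) : measurable_fun setT h ->
    measurable_fun setT (fun v => h v * ln (h v)).
  by move=> mh; exact: (measurable_funM mh (measurableT_comp (@measurable_ln R) mh)).
have entfp : (entropy fp <= K%:E)%E.
  rewrite (le_trans _ entf)// le_eqVlt; apply/orP; left; apply/eqP/esym.
  by apply: (ae_eq_integral_comp (G := fun v t => t * ln t)) => //; exact: mln.
have [A mA [kr Idelta]] := unif fp mfp fp0 massfp energyfp mPsifp entfp.
have cphi : continuous phi := sphi 0%N.
have dphi i v : is_derive v (delta_mx ord0 i) phi (partial phi i v).
  have [dp _] := sphi 1%N.
  by apply: derivableP; apply: diff_derivable; exact: dp.
have cdphi i : continuous (partial phi i) by have [_] := sphi 1%N; exact.
(* [g] is the function differentiated on the right-hand side, and phi^2 = g^2 <v>^2 brings the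
   left-hand side to the weighted potential. *)
pose g v := (bracket v)^-1 * phi v.
pose g' i v := (bracket v)^-1 * partial phi i v +
  phi v * (- (bracket v)^-1 ^+ 3 * v ord0 i).
have cbV := @continuous_bracketV R d.
have cg : continuous g by exact: continuous_funM.
have cg' i : continuous (g' i).
  apply: continuous_funD; first exact: continuous_funM.
  apply: continuous_funM => //; apply: continuous_funM; last exact: continuous_coord.
  apply: continuous_funN.
  exact: (continuous_funM cbV (continuous_sqr cbV)).
have dg i v : is_derive v (delta_mx ord0 i) g (g' i v).
  exact: (is_derive_mul (is_derive_bracketV v i) (dphi i v)).
have -> : (fun w => bracket w `^ (gamma / 2) * phi w) = g.
  apply/funext => w; rewrite hgamma (_ : - 2 / 2 = - 1); last by field.
  by rewrite powR_inv1// ltW// bracket_gt0.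
have -> : (\int[lebesgue_rV d]_v (enorm (grad g v) ^+ 2)%:E =
    \sum_(i < d) \int[lebesgue_rV d]_v (g' i v ^+ 2)%:E)%E.
  rewrite -ge0_integral_sum//; last 2 first.
  - move=> i; apply/measurable_EFinP; apply: continuous_measurable_rV.
    exact: continuous_sqr.
  - by move=> i v _; rewrite lee_fin sqr_ge0.
  apply: eq_integral => v _; rewrite enorm2 sumEFin; congr _%:E.
  by apply: eq_bigr => i _; rewrite mxE /partial; have [_ ->] := dg i v.
have gphi v : phi v ^+ 2 = g v ^+ 2 * (1 + enorm v ^+ 2).
  by rewrite -bracket2 /g; field; rewrite gt_eqF// bracket_gt0.
(* At t = 0 both sides are 0, so the two forms of the kernel agree on the diagonal as well. *)
have powN2 (t : R) : 0 <= t -> t `^ gamma = (t ^+ 2)^-1.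
  by move=> t0; rewrite hgamma powRN powR_mulrn.
have -> : (\int[lebesgue_rV d]_v (phi v ^+ 2 * bracket v `^ gamma)%:E =
    \int[lebesgue_rV d]_v (g v ^+ 2)%:E)%E.
  apply: eq_integral => v _; rewrite powN2 ?ltW ?bracket_gt0//.
  by rewrite gphi -bracket2 mulfK// gt_eqF// exprn_gt0// bracket_gt0.
set S := (\sum_(i < d) _)%E; set I := (\int[_]_v (g v ^+ 2)%:E)%E.
have S0 : (0 <= S)%E.
  by apply: sume_ge0 => i _; apply: integral_ge0 => v _; rewrite lee_fin sqr_ge0.
have I0 : (0 <= I)%E by apply: integral_ge0 => v _; rewrite lee_fin sqr_ge0.
have aC10 : (0 < (a * C1)%:E)%E by rewrite lte_fin mulr_gt0.
(* If [I] or [S] is infinite, the right-hand side is infinite, both terms being nonnegative.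
   Otherwise [g] and its partial derivatives are square integrable, as Hardy's inequality
   requires. *)
have [Ioo|Ioo] := eqVneq I +oo%E.
  rewrite Ioo (gt0_muley aC10) addey ?leey// -ltNye (lt_le_trans (ltNyr 0))//.
  by rewrite mule_ge0// ltW.
have [Soo|Soo] := eqVneq S +oo%E.
  rewrite Soo gt0_muley// addye ?leey// -ltNye (lt_le_trans (ltNyr 0))//.
  by rewrite mule_ge0// ltW.
have int2 (h : 'rV[R]_d -> R) : continuous h ->
    (\int[lebesgue_rV d]_v (h v ^+ 2)%:E < +oo)%E ->
    (lebesgue_rV d).-integrable setT (EFin \o (fun v => h v ^+ 2)).
  move=> ch hoo; apply/integrableP; split.
    apply/measurable_EFinP; apply: continuous_measurable_rV.
    exact: continuous_sqr.
  by under eq_integral do rewrite gee0_abs ?lee_fin ?sqr_ge0//.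
have ig : (lebesgue_rV d).-integrable setT (EFin \o (fun v => g v ^+ 2)).
  by apply: int2 => //; rewrite ltey.
have ig' i : (lebesgue_rV d).-integrable setT (EFin \o (fun v => g' i v ^+ 2)).
  apply: int2 => //; rewrite ltey; apply: contra_neq Soo => Sioo.
  rewrite /S (bigD1 i)//= Sioo addye//.
  rewrite -ltNye (lt_le_trans (ltNyr 0))// sume_ge0// => j _.
  by apply: integral_ge0 => v _; rewrite lee_fin sqr_ge0.
have main := weighted_potential_le hd mfp fp0 massfp mA kr Idelta cg cg' dg ig ig'.
rewrite -/S -/I -/C1 in main.
pose J v : \bar R := (\int[lebesgue_rV d]_w (fp w / enorm (v - w)%R ^+ 2)%:E)%E.
have mk v : measurable_fun setT (fun w : 'rV[R]_d => (enorm (v - w) ^+ 2)^-1).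
  apply: measurable_fun_inv => [w|]; first exact: sqr_ge0.
  exact: (measurableT_comp (@measurable_enorm2_sub R d) (pair1_measurable v)).
have J0 v : (0 <= J v)%E.
  by apply: integral_ge0 => w _; rewrite lee_fin mulr_ge0// invr_ge0 sqr_ge0.
have cJ v : c_coef gamma f v = (- (a%:E * J v))%E.
  rewrite /c_coef (_ : _ * (gamma + _) = a); last by rewrite hgamma /a; ring.
  rewrite EFinN mulNe; congr (- (_ * _))%E.
  under eq_integral do rewrite powN2 ?sqrtr_ge0// mulrC.
  pose G (w : 'rV[R]_d) (t : R) := t / enorm (v - w) ^+ 2.
  apply: (@ae_eq_integral_comp _ _ _ _ f fp G) => //; exact: measurable_funM.
have mJ : measurable_fun setT J.
  pose H (z : 'rV[R]_d * 'rV[R]_d) := (fp z.2 / enorm (z.1 - z.2) ^+ 2)%:E.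
  apply: (measurable_fun_fubini_tonelli_F H).
    apply/measurable_EFinP; apply: measurable_funM.
      exact: (measurableT_comp mfp measurable_snd).
    apply: measurable_fun_inv => [z|]; first exact: sqr_ge0.
    exact: measurable_enorm2_sub.
  by move=> z; rewrite lee_fin mulr_ge0// invr_ge0 sqr_ge0.
have mgJ : measurable_fun setT (fun v => (g v ^+ 2 * (1 + enorm v ^+ 2))%:E * J v)%E.
  apply: emeasurable_funM => //; apply/measurable_EFinP.
  apply: measurable_funM; last exact: measurable_funD.
  by apply: continuous_measurable_rV; exact: continuous_sqr.
have gJ0 v : (0 <= (g v ^+ 2 * (1 + enorm v ^+ 2))%:E * J v)%E.
  by rewrite mule_ge0// -gphi lee_fin sqr_ge0.
(* The integrand is the opposite of a nonnegative function, so the sign and the factor [a] come out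
   even when the integral is infinite. *)
have -> : (\int[lebesgue_rV d]_v ((phi v ^+ 2)%:E * c_coef gamma f v) =
    - (a%:E * \int[lebesgue_rV d]_v ((g v ^+ 2 * (1 + enorm v ^+ 2))%:E * J v)))%E.
  rewrite -ge0_integralZl//; last by rewrite lee_fin ltW.
  rewrite -integral_ge0N; last by move=> v _; rewrite mule_ge0// lee_fin ltW.
  by apply: eq_integral => v _; rewrite cJ muleN gphi muleCA.
rewrite oppeK.
apply: (@le_trans _ _ (a%:E * ((8 * delta)%:E * S + C1%:E * I))%E).
  by rewrite lee_pmul2l.
rewrite ge0_muleDr; last 2 first.
- by rewrite mule_ge0// lee_fin mulr_ge0// ltW.
- by rewrite mule_ge0// lee_fin ltW.
rewrite !muleA -!EFinM (_ : a * (8 * delta) = eps)//.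
by rewrite /delta; field; rewrite gt_eqF.
Qed.
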